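(* Let $\delta>0$, $\gamma\in\mathbb{R}$, $g\in l^2$, and let $r>\frac{2}{\delta}\|g\|_{l^2}$. Then the semigroup $\{S_\gamma(t)\}_{t\ge0}$ associated with the dfDNLS has a unique global attractor $\mathcal{A}_\gamma\subset B_r\subset l^2$.
   Context: $l^2$ is the Hilbert space of complex sequences $\varphi=(\varphi_n)_{n\in\mathbb{Z}}$ with $\|\varphi\|_{l^2}=(\sum_n|\varphi_n|^2)^{1/2}<\infty$, and $B_R=\{\varphi\in l^2:\|\varphi\|_{l^2}<R\}$. The damped and forced discrete nonlinear Schrödinger equation (dfDNLS) is $$i\frac{d\phi_n}{dt}=(\phi_{n+1}-2\phi_n+\phi_{n-1})+\gamma|\phi_n|^2\phi_n-i\delta\phi_n+g_n,\quad n\in\mathbb{Z},$$ with $\phi_n(0)=\phi_{n,0}$. For every $\phi_0\in l^2$ it has a unique solution $\phi\in C^1([0,\infty),l^2)$, and $S_\gamma(t):\phi_0\mapsto\phi(t)$, $t\ge0$, is the associated continuous semigroup on $l^2$. Global attractor: $\mathcal{A}_\gamma\subset l^2$ is a global attractor for $\{S_\gamma(t)\}_{t\ge0}$ in $l^2$ if it is (i) a nonempty compact subset of $l^2$, (ii) invariant, i.e. $S_\gamma(t)\mathcal{A}_\gamma=\mathcal{A}_\gamma$ for all $t\ge0$, and (iii) attracting, i.e. for all bounded $B\subset l^2$, $\lim_{t\to\infty}\mathrm{dist}(S_\gamma(t)B,\mathcal{A}_\gamma)=0$, where $\mathrm{dist}(U,V)=\sup_{u\in U}\inf_{v\in V}\|u-v\|_{l^2}$.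 *)

(* Defs.v *)
From HB Require Import structures.
From mathcomp Require Import all_boot all_order all_algebra.
From mathcomp Require Import ring lra complex.
From mathcomp Require Import all_classical all_reals all_analysis.

Set Implicit Arguments.
Unset Strict Implicit.
Unset Printing Implicit Defensive.

Import Order.TTheory GRing.Theory Num.Theory.
Import numFieldNormedType.Exports.

Local Open Scope complex_scope.
Local Open Scope classical_set_scope.
Local Open Scope ring_scope.

(* [Rcomplex R] is [R[i]] viewed as a normed space over [R]: the modulus is
   [R]-valued and [a *: z] is multiplication of [z] by the real number [a]. *)

Definition sqsum (R : realType) (u : int -> Rcomplex R) : \bar R :=
  (\esum_(n in [set: int]) (`|u n| ^+ 2)%:E)%E.

Definition l2_pred (R : realType) : pred (int -> Rcomplex R) :=
  [pred u | (sqsum u < +oo)%E].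

Record l2 (R : realType) := L2 {
  l2_val :> int -> Rcomplex R;
  _ : l2_pred l2_val
}.

HB.instance Definition _ (R : realType) := [isSub for @l2_val R].
HB.instance Definition _ (R : realType) := [Choice of l2 R by <:].

Section l2_space.
Context {R : realType}.
Implicit Types (u v : int -> Rcomplex R) (c : R).

Lemma sqsum_ge0 u : (0 <= sqsum u)%E.
Proof. by apply: esum_ge0 => n _; rewrite lee_fin sqr_ge0. Qed.

Lemma esumZl_le (a : int -> \bar R) c : 0 <= c -> (forall n, 0 <= a n)%E ->
  (\esum_(n in [set: int]) (c%:E * a n) <=
   c%:E * \esum_(n in [set: int]) a n)%E.
Proof.
move=> c0 a0; apply: ge_ereal_sup => _ [X [finX _] <-].
rewrite -ge0_mule_fsumr//; apply: lee_wpmul2l; first by rewrite lee_fin.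
by apply: ereal_sup_ubound; exists X.
Qed.

Lemma normcZ c (z : Rcomplex R) : `|c *: z| = `|c| * `|z|.
Proof.
case: z => x y; rewrite -sqrtr_sqr.
rewrite -[LHS]/(Num.sqrt ((c * x) ^+ 2 + (c * y) ^+ 2)).
rewrite -[X in _ = _ * X]/(Num.sqrt (x ^+ 2 + y ^+ 2)).
by rewrite -sqrtrM ?sqr_ge0// !exprMn mulrDr.
Qed.

Lemma sqsumZ_le c u : (sqsum (c *: u) <= (c ^+ 2)%:E * sqsum u)%E.
Proof.
rewrite /sqsum; apply: le_trans (esumZl_le _ _); last 2 first.
- exact: sqr_ge0.
- by move=> n; rewrite lee_fin sqr_ge0.
apply: le_esum => n _; rewrite -EFinM lee_fin.
by rewrite normcZ exprMn real_normK ?num_real.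
Qed.

(* Young's inequality, with [b = 1] for stability under sums and
   [b = norm v / norm u] for the triangle inequality. *)
Lemma sqsumD_le (b : R) u v : 0 < b ->
  (sqsum (u + v)%R <= (1 + b)%:E * sqsum u + (1 + b^-1)%:E * sqsum v)%E.
Proof.
move=> b0; have bV0 : 0 < b^-1 by rewrite invr_gt0.
have sq0 (w : int -> Rcomplex R) n : (0 <= (`|w n| ^+ 2)%:E)%E.
  by rewrite lee_fin sqr_ge0.
rewrite /sqsum; apply: le_trans (leeD (esumZl_le _ (sq0 u)) (esumZl_le _ (sq0 v))).
- rewrite -esumD; last 2 first.
  + by move=> n _; rewrite mule_ge0// lee_fin addr_ge0// ltW.
  + by move=> n _; rewrite mule_ge0// lee_fin addr_ge0// ltW.
  apply: le_esum => n _; rewrite -!EFinM -EFinD lee_fin.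
  apply: (@le_trans _ _ ((`|u n| + `|v n|) ^+ 2)).
    by rewrite lerXn2r ?nnegrE ?addr_ge0// ler_normD.
  rewrite -subr_ge0 (_ : _ - _ = b * (`|u n| - b^-1 * `|v n|) ^+ 2).
    by rewrite mulr_ge0 ?sqr_ge0// ltW.
  by move: `|u n| `|v n| => x y; field; rewrite gt_eqF.
- by rewrite addr_ge0// ltW.
- by rewrite addr_ge0// ltW.
Qed.

Fact l2_submod : subsemimod_closed (@l2_pred R).
Proof.
split=> [|c u]; last first.
  rewrite !inE => uoo; apply: le_lt_trans (sqsumZ_le c u) _.
  by rewrite lte_mul_pinfty// lee_fin sqr_ge0.
split=> [|u v]; rewrite !inE.
  by rewrite /sqsum esum1// => n _; rewrite normr0 expr0n.
move=> uoo voo; apply: le_lt_trans (sqsumD_le u v ltr01) _.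
by apply: lte_add_pinfty; apply: lte_mul_pinfty;
  rewrite ?lee_fin ?addr_ge0 ?invr_ge0.
Qed.

End l2_space.

HB.instance Definition _ (R : realType) :=
  GRing.isSubSemiModClosed.Build R (int -> Rcomplex R) (@l2_pred R)
    l2_submod.
HB.instance Definition _ (R : realType) :=
  [SubChoice_isSubLmodule of l2 R by <:].

Definition l2norm (R : realType) (u : l2 R) : R := Num.sqrt (fine (sqsum u)).

Section l2_norm.
Context {R : realType}.
Implicit Types (u v : l2 R) (c : R).

Lemma sqsumE u : sqsum u = (l2norm u ^+ 2)%:E.
Proof.
have ufin : sqsum u \is a fin_num by rewrite ge0_fin_numE ?sqsum_ge0//; case: u.
by rewrite sqr_sqrtr ?fine_ge0 ?sqsum_ge0// fineK.
Qed.

Fact l2norm0_eq0 u : l2norm u = 0 -> u = 0.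
Proof.
move=> u0; apply/val_inj/funext => n; apply/eqP; rewrite -normr_eq0 -sqrf_eq0.
rewrite eq_le sqr_ge0 andbT -lee_fin.
apply: (@le_trans _ _ (sqsum u)); last by rewrite sqsumE u0 expr0n.
apply: esum_ge; exists [set n]; first by split.
by rewrite fsbig_set1.
Qed.

Fact ler_l2normD u v : l2norm (u + v) <= l2norm u + l2norm v.
Proof.
have [u0|u0] := eqVneq (l2norm u) 0.
  by rewrite (l2norm0_eq0 u0) add0r lerDr sqrtr_ge0.
have [v0|v0] := eqVneq (l2norm v) 0.
  by rewrite (l2norm0_eq0 v0) addr0 lerDl sqrtr_ge0.
have up : 0 < l2norm u by rewrite lt_neqAle eq_sym u0 sqrtr_ge0.
have vp : 0 < l2norm v by rewrite lt_neqAle eq_sym v0 sqrtr_ge0.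
rewrite -(@ler_pXn2r _ 2)// ?nnegrE ?addr_ge0 ?sqrtr_ge0// -lee_fin -sqsumE.
apply: le_trans (sqsumD_le u v (divr_gt0 vp up)) _.
rewrite !sqsumE -!EFinM -EFinD lee_fin le_eqVlt; apply/orP; left; apply/eqP.
by field; rewrite u0 v0.
Qed.

Fact l2normZ c u : l2norm (c *: u) = `|c| * l2norm u.
Proof.
have leZ d v : l2norm (d *: v) <= `|d| * l2norm v.
  rewrite -(@ler_pXn2r _ 2)// ?nnegrE ?mulr_ge0 ?sqrtr_ge0//.
  rewrite -lee_fin -sqsumE exprMn real_normK ?num_real// EFinM -sqsumE.
  exact: sqsumZ_le.
have [->|c0] := eqVneq c 0.
  apply/eqP; rewrite eq_le leZ /= normr0 mul0r; exact: sqrtr_ge0.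
apply/eqP; rewrite eq_le leZ /= -ler_pdivlMl ?normr_gt0// -normfV.
by rewrite -{1}[u](scalerK c0) leZ.
Qed.

End l2_norm.

HB.instance Definition _ (R : realType) :=
  Lmodule_isNormed.Build R (l2 R) ler_l2normD l2normZ l2norm0_eq0.

(* [C^1] on the closed half-line with values in [l^2]; the difference quotient
   is one-sided at [t = 0], and [phi] is unconstrained at negative times. *)
Definition C1_with_derivative (R : realType) (phi dphi : R -> l2 R) : Prop :=
  {within `[0, +oo[, continuous dphi} /\
  forall t : R, 0 <= t ->
    (fun h : R => h^-1 *: (phi (t + h) - phi t))
      @ within [set h | 0 <= t + h] 0^' --> dphi t.

Definition dfDNLS_solution (R : realType) (delta gamma : R) (g phi0 : l2 R)
    (phi : R -> l2 R) : Prop :=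
  let i : Rcomplex R := 'i%C in
  phi 0 = phi0 /\
  exists2 dphi : R -> l2 R, C1_with_derivative phi dphi &
    forall t : R, 0 <= t -> forall n : int,
      i * dphi t n =
        (phi t (n + 1) - 2 * phi t n + phi t (n - 1))
        + (gamma * `|phi t n| ^+ 2) *: phi t n
        - i * (delta *: phi t n) + g n.

(* [S] is the solution map [phi0 |-> phi(t)]: solutions being unique, this
   determines [S t] for [0 <= t]; negative times are unconstrained. *)
Definition dfDNLS_semigroup (R : realType) (delta gamma : R) (g : l2 R)
    (S : R -> l2 R -> l2 R) : Prop :=
  forall phi0 : l2 R, dfDNLS_solution delta gamma g phi0 (fun t => S t phi0).

(* The supremum is taken in [[0, +oo]]: adjoining [0] makes the distance from
   the empty set equal to [0] (the supremum of the empty set in [\bar R] is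
   [-oo]) and changes nothing when [U] is nonempty. *)
Definition semidist (R : realType) (V : normedModType R) (U W : set V)
    : \bar R :=
  ereal_sup (0%E |` [set ereal_inf [set `|u - w|%:E | w in W] | u in U]).

Definition global_attractor (R : realType) (V : normedModType R)
    (S : R -> V -> V) (A : set V) : Prop :=
  [/\ A !=set0, compact A,
      forall t : R, 0 <= t -> S t @` A = A &
      forall B : set V, bounded_set B ->
        semidist (S t @` B) A @[t --> +oo%R] --> 0%E].

(* Main.v *)
Require Import Defs.
From mathcomp Require Import all_boot all_order all_algebra.
From mathcomp Require Import ring lra zify complex.
From mathcomp Require Import all_classical all_reals all_analysis.
Import Order.TTheory GRing.Theory Num.Theory.
Import numFieldNormedType.Exports.
Local Open Scope classical_set_scope.
Local Open Scope ring_scope.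

Set Implicit Arguments.
Unset Strict Implicit.
Unset Printing Implicit Defensive.

(** In the energy [\sum_n w n * |phi_n|^2] with a finitely supported weight [w],
   the discrete Laplacian contributes only
   [\sum_n (w n - w (n + 1)) * Im (conj phi_n * phi_(n + 1))] (up to a factor
   2), which is small when [w] varies slowly, and the nonlinearity contributes
   nothing. Gronwall's lemma then bounds the norm (weights tending to 1), the
   tails (weights vanishing near 0), and, applied to a difference of two
   solutions, gives Lipschitz dependence on the initial data. A bounded set of
   sequences with uniformly small tails is relatively compact, so the
   omega-limit set of an absorbing ball is the attractor; letting [t] tend to
   infinity in the norm bound on an invariant bounded set places it in the
   closed ball of radius [|g| / delta]. *)

(** * Attractors of semigroups *)

Section attractors.
Context {R : realType} {V : normedModType R}.
Implicit Types (S : R -> V -> V) (A B U W : set V).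

Lemma semidist_ge0 U W : (0 <= semidist U W)%E.
Proof. by apply: ereal_sup_ubound; left. Qed.

Lemma semidist_le U W (e : R) : 0 <= e ->
  (forall u, U u -> exists2 w, W w & `|u - w| <= e) -> (semidist U W <= e%:E)%E.
Proof.
move=> e0 UW; apply: ge_ereal_sup => _ [->|[u Uu <-]]; first by rewrite lee_fin.
have [w Ww uw] := UW _ Uu.
by apply: (@le_trans _ _ `|u - w|%:E); [apply: ereal_inf_lbound; exists w|].
Qed.

Lemma semidist_lt U W (e : R) : (semidist U W < e%:E)%E ->
  forall u, U u -> exists2 w, W w & `|u - w| < e.
Proof.
move=> UWe u Uu.
have : (ereal_inf [set `|u - w|%:E | w in W] < e%:E)%E.
  by apply: le_lt_trans UWe; apply: ereal_sup_ubound; right; exists u.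
by move=> /ereal_inf_lt[_ [w Ww <-]]; rewrite lte_fin; exists w.
Qed.

Lemma semidist_cvg0 (U : R -> set V) W :
  (forall e : R, 0 < e -> \forall t \near +oo%R,
    forall u, U t u -> exists2 w, W w & `|u - w| <= e) ->
  semidist (U t) W @[t --> +oo%R] --> 0%E.
Proof.
move=> H; apply/fine_cvgP; split.
  near=> t; rewrite ge0_fin_numE ?semidist_ge0//.
  apply: le_lt_trans (ltry 1); apply: semidist_le => //.
  by near: t; exact: H.
apply/cvgrPdist_le => e e0; near=> t.
have ste : (semidist (U t) W <= e%:E)%E.
  by apply: semidist_le; [exact: ltW|near: t; exact: H].
rewrite sub0r normrN ger0_norm ?fine_ge0 ?semidist_ge0//.
rewrite -lee_fin fineK// ge0_fin_numE ?semidist_ge0//.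
exact: le_lt_trans ste (ltry _).
Unshelve. all: by end_near. Qed.

(** A global attractor [A'] is bounded and equals its image at every time [t >= 0], so attraction by
    [A] makes [semidist A' A] arbitrarily small; [A] being closed, it contains [A']. Exchanging the
    roles gives uniqueness. *)
Lemma global_attractor_subset S A A' :
  global_attractor S A -> global_attractor S A' -> A' `<=` A.
Proof.
move=> [_ cA _ attA] [_ cA' invA' _] p A'p.
have clA : closed A by apply: compact_closed => //; exact: norm_hausdorff.
have /attA /fine_cvgP[fin cvg0] : bounded_set A' by exact: compact_bounded.
apply: clA => N /nbhs_ballP[e /= e0 Ne].
have [t /andP[t0 /andP[ft dt]]] : exists t, (0 <= t) &&
    ((semidist (S t @` A') A \is a fin_num) && (fine (semidist (S t @` A') A) < e)).
  have := @filter_ex _ (nbhs +oo%R) _ [set t | (0 <= t) &&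
    ((semidist (S t @` A') A \is a fin_num) && (fine (semidist (S t @` A') A) < e))].
  move=> [|t]; last by exists t.
  near=> t; apply/andP; split; first by near: t; exact: nbhs_pinfty_ge.
  apply/andP; split; first by near: t.
  near: t; move/cvgrPdist_lt : cvg0 => /(_ _ e0); apply: filterS => t.
  by rewrite sub0r normrN; apply: le_lt_trans; rewrite ler_norm.
have : (semidist A' A < e%:E)%E.
  by rewrite -(invA' _ t0) -(fineK ft) lte_fin.
move=> /semidist_lt/(_ _ A'p)[w Aw pw]; exists w; split=> //.
by apply: Ne; rewrite -ball_normE.
Unshelve. all: by end_near. Qed.

(** * Omega-limit set of an absorbing set *)

Definition orbit_tail S B (s : R) : set V :=
  \bigcup_(t in [set t | s <= t]) (S t @` B).

Definition omega_limit S B : set V :=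
  \bigcap_(s in [set s | 0 <= s]) closure (orbit_tail S B s).

Lemma orbit_tail_anti S B s s' : s <= s' -> orbit_tail S B s' `<=` orbit_tail S B s.
Proof. by move=> ss' v [t /= st Bv]; exists t => //=; exact: le_trans ss' st. Qed.

Context {S : R -> V -> V} {B : set V}.
Context (semigroup : forall (s t : R) u, 0 <= s -> 0 <= t -> S (s + t) u = S s (S t u)).
Context (cts : forall t : R, 0 <= t -> continuous (S t)).
Context (B_neq0 : B !=set0).
Context (B_absorbing : forall B', bounded_set B' ->
  exists2 s : R, 0 <= s & forall t, s <= t -> S t @` B' `<=` B).
(** Ultrafilters replace sequences [S t_k u_k] with [t_k] tending to infinity. Closures of the tails
    appear because points of the omega-limit set are only known to lie there. *)
Context (asymptotically_compact : forall G : set_system V, UltraFilter G ->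
  (forall s : R, 0 <= s -> G (closure (orbit_tail S B s))) -> exists p : V, G --> p).

Let O := orbit_tail S B.
Let A := omega_limit S B.

Let ultra_cvg_A G : UltraFilter G ->
  (forall s : R, 0 <= s -> G (closure (O s))) -> exists2 p : V, A p & G --> p.
Proof.
move=> GU GO; have [p Gp] := asymptotically_compact GU GO.
exists p => // s s0; apply: closed_closure => N /Gp GN.
by have [q []] := @filter_ex _ G _ _ (filterI (GN : G N) (GO _ s0)); exists q.
Qed.

(** The property behind nonemptiness, invariance and attraction. If no tail were inside [U], the
    sets [O s] minus [U] would generate a proper filter, and an ultrafilter refining it would
    converge to a point of [A], whose neighbourhood [U] it avoids. *)
Let O_sub_open U : open U -> A `<=` U -> exists2 s : R, 0 <= s & O s `<=` U.
Proof.
move=> oU AU; apply: contrapT => nO.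
pose F := filter_from [set s : R | 0 <= s] (fun s => O s `\` U).
have FF : ProperFilter F.
  apply: filter_from_proper; last first.
    move=> s s0; apply/set0P/negP => /eqP; rewrite setD_eq0 => OU.
    by apply: nO; exists s.
  apply: filter_from_filter; first by exists 0 => /=.
  move=> s s' /= s0 s'0; exists (Num.max s s') => /=; first by rewrite le_max s0.
  move=> v [Ov nUv]; split; split=> //; apply: orbit_tail_anti Ov;
    by rewrite le_max lexx ?orbT.
have [G [GU FG]] := ultraFilterLemma FF.
have GOU s : 0 <= s -> G (O s `\` U) by move=> s0; apply: FG; exists s.
have [p Ap Gp] : exists2 p : V, A p & G --> p.
  apply: ultra_cvg_A => s s0; apply: filterS (GOU _ s0) => v [+ _].
  exact: subset_closure.
have GUU : G U by apply: Gp; apply: open_nbhs_nbhs; split=> //; exact: AU.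
by have [q [? []]] := @filter_ex _ G _ _ (filterI GUU (GOU _ (lexx 0))).
Qed.

Let compact_A : compact A.
Proof.
rewrite compact_ultra => G GU GA.
have [p Ap Gp] : exists2 p : V, A p & G --> p; last by exists p.
by apply: ultra_cvg_A => s s0; apply: filterS GA => v; exact.
Qed.

Let neq0_A : A !=set0.
Proof.
have [//|/set0P/negP/negbNE/eqP A0] := pselect (A !=set0).
have [] := @O_sub_open set0; [exact: open0|by rewrite A0|].
move=> s s0; have [u Bu] := B_neq0.
by move=> /(_ (S s u)) []; exists s => //=; exists u.
Qed.

Let invariant_A t : 0 <= t -> S t @` A = A.
Proof.
move=> t0; apply/seteqP; split=> [_ [p Ap <-] s s0 N /(cts t0) /(Ap _ s0)|p Ap].
  move=> [_ [[a /= sa [u Bu <-]] Nu]]; exists (S t (S a u)); split=> //.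
  exists (t + a); first by rewrite /= -[s]add0r lerD.
  by exists u => //; rewrite semigroup//; exact: le_trans sa.
(* If [p] were outside the image of [A], which is compact and so closed, a closed ball around [p]
   would miss that image, and the preimage of its complement would contain a tail [O s]. But some
   [S a u] with [a >= s + t] falls in the ball, while [S (a - t) u] lies in that tail. *)
apply: contrapT => nStp.
have clSA : closed (S t @` A).
  apply: compact_closed; first exact: norm_hausdorff.
  apply: continuous_compact compact_A; apply: continuous_subspaceT.
  exact: cts.
have [e /= e0 pe] : exists2 e, 0 < e & ball p e `<=` ~` (S t @` A).
  apply/nbhs_ballP/open_nbhs_nbhs; split=> //; exact: closed_openC.
have e20 : 0 < e / 2 by rewrite divr_gt0.
have [] := @O_sub_open (S t @^-1` (~` closed_ball p (e / 2))).
- apply: open_comp; first by move=> x _; exact: cts.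
  by apply: closed_openC; exact: closed_ball_closed.
- have e2e : e / 2 < e by rewrite ltr_pdivrMr// mulr_natr mulr2n ltrDl.
  move=> q Aq /= qp; suff /pe : ball p e (S t q) by apply; exists q.
  exact: (closed_ball_subset e20 e2e) qp.
move=> s s0 OU.
have [_ [[a /= sta [u Bu <-]] pS]] :=
  Ap _ (addr_ge0 s0 t0) _ (nbhsx_ballx p _ e20).
have sat : s <= a - t by rewrite lerBrDr.
have /OU/= : O s (S (a - t) u) by exists (a - t) => //; exists u.
rewrite -semigroup//; last exact: le_trans sat.
by rewrite addrC subrK; apply; exact: subset_closed_ball.
Qed.

Lemma omega_limit_global_attractor : global_attractor S A.
Proof.
split=> // B' bB'; apply: semidist_cvg0 => e e0.
have [s s0 sB] := B_absorbing bB'.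
(* The [e]-neighbourhood of [A] contains a tail [O a]; orbits from [B'] are in [B] from time [s] on,
   hence in that tail from time [a + s] on. *)
have [] := @O_sub_open (\bigcup_(w in A) ball w e).
- by apply: bigcup_open => w _; exact: ball_open.
- by move=> w Aw; exists w => //; exact: ballxx.
move=> a a0 OA; exists (a + s); split; first exact: num_real.
move=> t /ltW ast _ [u B'u <-].
have [|w Aw] := OA (S t u).
  exists a => //=; exists (S (t - a) u).
    by apply: (sB (t - a)); [rewrite lerBrDl|exists u].
  rewrite -semigroup//; first by rewrite addrC subrK.
  by rewrite subr_ge0; apply: le_trans ast; rewrite lerDl.
by rewrite -ball_normE/= distrC => /ltW; exists w.
Qed.

End attractors.

(** * Coordinates, tails and compactness in l2 *)

(** The integers from [-N] to [N] in increasing order, so that sums over a box telescope. *)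
Definition box (N : nat) : seq int := [seq k%:Z - N%:Z | k <- iota 0 N.*2.+1].

Lemma mem_box N n : (n \in box N) = (absz n <= N)%N.
Proof.
apply/mapP/idP => [[k]|nN].
  by rewrite mem_iota add0n => /andP[_ kN] ->; lia.
exists (absz (n + N%:Z)); last by lia.
by rewrite mem_iota add0n; lia.
Qed.

Lemma box_uniq N : uniq (box N).
Proof. by rewrite map_inj_uniq ?iota_uniq// => i j; lia. Qed.

Lemma big_box_sub (T : Type) (idx : T) (op : Monoid.com_law idx) K N (F : int -> T) :
  (K <= N)%N ->
  \big[op/idx]_(n <- box K) F n =
  \big[op/idx]_(n <- box N | (absz n <= K)%N) F n.
Proof.
move=> KN; rewrite -[RHS]big_filter; apply: perm_big; apply: uniq_perm.
- exact: box_uniq.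
- exact/filter_uniq/box_uniq.
- by move=> n; rewrite mem_filter !mem_box; lia.
Qed.

Lemma sqr_le_of_le_add (R : realFieldType) (a b c : R) :
  0 <= a -> a <= b + c -> a ^+ 2 <= 2 * b ^+ 2 + 2 * c ^+ 2.
Proof.
move=> a0 abc; apply: (@le_trans _ _ ((b + c) ^+ 2)).
  by rewrite ler_pXn2r// nnegrE (le_trans a0).
by have := sqr_ge0 (b - c); nra.
Qed.

Lemma cvg_sum_seq (R : realType) (T I : Type) (F : set_system T) (r : seq I)
    (f : I -> T -> R) (a : I -> R) : Filter F ->
  (forall i, f i x @[x --> F] --> a i) ->
  \sum_(i <- r) f i x @[x --> F] --> \sum_(i <- r) a i.
Proof. by move=> FF fa; apply: cvg_big => //; exact: add_continuous. Qed.

Section l2_coordinates.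
Context {R : realType}.
Implicit Types (u v : int -> Rcomplex R) (x y : l2 R).

Lemma sqr_normRcomplex (z : Rcomplex R) : `|z| ^+ 2 = complex.Re z ^+ 2 + complex.Im z ^+ 2.
Proof.
case: z => a b; rewrite -[`|_|]/(Num.sqrt (a ^+ 2 + b ^+ 2)) sqr_sqrtr//.
by rewrite addr_ge0 ?sqr_ge0.
Qed.

Lemma normr_Re_le (z : Rcomplex R) : `|complex.Re z| <= `|z|.
Proof.
rewrite -(@ler_pXn2r _ 2)// ?nnegrE// sqr_normRcomplex.
by rewrite real_normK ?num_real// lerDl sqr_ge0.
Qed.

Lemma normr_Im_le (z : Rcomplex R) : `|complex.Im z| <= `|z|.
Proof.
rewrite -(@ler_pXn2r _ 2)// ?nnegrE// sqr_normRcomplex.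
by rewrite real_normK ?num_real// lerDr sqr_ge0.
Qed.

Lemma l2B_coord x y n : (x - y) n = x n - y n.
Proof. by []. Qed.

Lemma l2Z_coord (c : R) x n : (c *: x) n = c *: x n.
Proof. by []. Qed.

Lemma sum_le_sqsum u (s : seq int) : uniq s ->
  ((\sum_(n <- s) `|u n| ^+ 2)%:E <= sqsum u)%E.
Proof.
move=> us; apply: esum_ge; exists [set` s]; first by split=> //; exact: finite_seq.
by rewrite -fsbig_seq// sumEFin.
Qed.

Lemma sum_le_sqnorm x (s : seq int) : uniq s ->
  \sum_(n <- s) `|x n| ^+ 2 <= `|x| ^+ 2.
Proof. by move=> us; rewrite -lee_fin -sqsumE sum_le_sqsum. Qed.

Lemma coord_le x n : `|x n| <= `|x|.
Proof.
rewrite -(@ler_pXn2r _ 2)// ?nnegrE//.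
by have := @sum_le_sqnorm x [:: n] isT; rewrite big_seq1.
Qed.

Definition boxsum N u := \sum_(n <- box N) `|u n| ^+ 2.

Lemma boxsum_le_sqnorm N x : boxsum N x <= `|x| ^+ 2.
Proof. exact/sum_le_sqnorm/box_uniq. Qed.

(** The full sum is a supremum over finite index sets, each of which lies in a box. Norm estimates
    can thus be proved on box sums. *)
Lemma sqsum_le u (C : R) : (forall N, boxsum N u <= C) -> (sqsum u <= C%:E)%E.
Proof.
move=> uC; apply: ge_ereal_sup => _ [X [finX _] <-].
have /finite_seqP[s Xs] := finX; pose N := \max_(n <- s) absz n.
apply: (@le_trans _ _ (boxsum N u)%:E); last by rewrite lee_fin.
rewrite /boxsum -sumEFin (fsbig_seq _ _ (box_uniq N)).
apply: lee_fsum_nneg_subset => //.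
  move=> n; rewrite Xs !inE /= mem_box => ns.
  exact: leq_bigmax_seq.
Qed.

Lemma sqnorm_le x (C : R) : (forall N, boxsum N x <= C) -> `|x| ^+ 2 <= C.
Proof. by move=> xC; rewrite -lee_fin -sqsumE sqsum_le. Qed.

Lemma boxsumB K N u : (K <= N)%N ->
  boxsum N u - boxsum K u = \sum_(n <- box N | ~~ (absz n <= K)%N) `|u n| ^+ 2.
Proof.
move=> KN; rewrite {1}/boxsum (bigID (fun n => (absz n <= K)%N))/=.
by rewrite -(big_box_sub _ _ KN) addrAC subrr add0r.
Qed.

Lemma boxsum_mono K N u : (K <= N)%N -> boxsum K u <= boxsum N u.
Proof.
by move=> KN; rewrite -subr_ge0 boxsumB// sumr_ge0// => n _; exact: sqr_ge0.
Qed.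

Lemma boxsum_cvg x : boxsum N x @[N --> \oo] --> `|x| ^+ 2.
Proof.
have ub : has_ubound (range (fun N => boxsum N x)).
  by exists (`|x| ^+ 2) => _ [N _ <-]; exact: boxsum_le_sqnorm.
have := nondecreasing_cvgn (fun K N => @boxsum_mono K N x) ub.
suff -> : sup (range (fun N => boxsum N x)) = `|x| ^+ 2 by [].
apply/eqP; rewrite eq_le; apply/andP; split.
  apply: ge_sup; first by exists (boxsum 0 x); exists 0%N.
  by move=> _ [N _ <-]; exact: boxsum_le_sqnorm.
by apply: sqnorm_le => N; apply: ub_le_sup => //; exists N.
Qed.


(** Outside the box [K], [|x n - y n|^2 <= 2 |x n|^2 + 2 |y n|^2], so the two tails contribute at
    most [2 e] each. *)
Lemma sqnormB_le (x y : l2 R) K (e : R) :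
  `|x| ^+ 2 - boxsum K x <= e -> `|y| ^+ 2 - boxsum K y <= e ->
  `|x - y| ^+ 2 <= boxsum K (x - y : l2 R) + 4 * e.
Proof.
move=> xe ye; apply: sqnorm_le => N.
wlog KN : N / (K <= N)%N.
  move=> H; have [/H//|NK] := leqP K N.
  exact: le_trans (boxsum_mono _ (ltnW NK)) (H _ (leqnn K)).
rewrite -lerBlDl boxsumB//.
apply: (@le_trans _ _ (2 * (boxsum N x - boxsum K x) + 2 * (boxsum N y - boxsum K y))).
  rewrite !boxsumB// !mulr_sumr -big_split; apply: ler_sum => n _.
 rewrite l2B_coord /=; have := ler_normB (x n) (y n).
  exact: sqr_le_of_le_add.
by have := boxsum_le_sqnorm N x; have := boxsum_le_sqnorm N y; lra.
Qed.

(** By compactness of [[- M, M]] the image of [G] has a cluster point, and an ultrafilter converges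
    to each of its cluster points. *)
Lemma ultra_bounded_cvg (T : Type) (G : set_system T) (f : T -> R) (M : R) :
  UltraFilter G -> G [set t | `|f t| <= M] -> exists a : R, f @ G --> a.
Proof.
move=> GU GM.
have [a [_ clfa]] : `[- M, M] `&` cluster (f @ G) !=set0.
  apply: segment_compact.
  change (G (f @^-1` `[- M, M])); apply: filterS GM => t /=.
  by rewrite in_itv/= ler_norml.
exists a => N Na; rewrite /= /fmap/=.
have [//|GN] := in_ultra_setVsetC (f @^-1` N) GU.
have [y [NNy Ny]] := clfa (~` N) N GN Na.
by have := NNy Ny.
Qed.

(* Coordinatewise limits exist because bounded sets of [R] are relatively
   compact, and the uniform smallness of the tails makes them norm limits. *)
Lemma l2_ultra_cvg (G : set_system (l2 R)) (M : R) : UltraFilter G ->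
  G [set x : l2 R | `|x| <= M] ->
  (forall e : R, 0 < e -> exists K, G [set x : l2 R | `|x| ^+ 2 - boxsum K x <= e]) ->
  exists p : l2 R, G --> p.
Proof.
move=> GU GM Gtail.
have bnd n (f : Rcomplex R -> R) : (forall z, `|f z| <= `|z|) ->
    exists a : R, (fun x : l2 R => f (x n)) @ G --> a.
  move=> fz; apply: (@ultra_bounded_cvg _ _ _ M) => //.
  apply: filterS GM => x /=; apply: le_trans.
  exact: le_trans (fz _) (coord_le _ _).
have /choice[a Ga] : forall n, exists a : R, (fun x : l2 R => complex.Re (x n)) @ G --> a.
  by move=> n; apply: bnd; exact: normr_Re_le.
have /choice[b Gb] : forall n, exists a : R, (fun x : l2 R => complex.Im (x n)) @ G --> a.
  by move=> n; apply: bnd; exact: normr_Im_le.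
pose p0 n : Rcomplex R := (a n +i* b n)%C.
have Gsum N : (fun x : l2 R => boxsum N x) @ G --> boxsum N p0.
  apply: cvg_sum_seq => n; rewrite sqr_normRcomplex.
  under eq_cvg do rewrite sqr_normRcomplex !expr2.
  by rewrite !expr2; apply: cvgD; apply: cvgM; by [exact: Ga|exact: Gb].
have p0M N : boxsum N p0 <= M ^+ 2.
  apply: (cvgr_to_le (Gsum N)); near=> x; have xM : `|x| <= M by near: x.
  apply: le_trans (boxsum_le_sqnorm N x) _.
  by apply: lerXn2r => //; rewrite nnegrE//; exact: le_trans xM.
have p0l2 : l2_pred p0 by apply: le_lt_trans (sqsum_le p0M) (ltry _).
pose p := L2 p0l2.
exists p; apply/fcvgrPdist_lt => e e0.
(* [sqnormB_le] turns two tails of size [e^2 / 8] into [e^2 / 2]; the other half of [e^2] is left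
   for the box sum. *)
have e8 : 0 < e ^+ 2 / 8 by rewrite divr_gt0// exprn_gt0.
have [K GK] := Gtail _ e8.
(* The limit inherits the tail bound: [boxsum N p - boxsum K p] is the limit along [G] of the same
   quantity for [x], which the tail of [x] dominates. *)
have pK : `|p| ^+ 2 - boxsum K p <= e ^+ 2 / 8.
  rewrite lerBlDr; apply: sqnorm_le => N; rewrite -lerBlDr.
  apply: (cvgr_to_le (cvgB (Gsum N) (Gsum K))); near=> x.
  apply: (@le_trans _ _ (`|x| ^+ 2 - boxsum K x)); last by near: x.
  by rewrite lerD2r boxsum_le_sqnorm.
have Gd : (fun x : l2 R => boxsum K (p - x : l2 R)) @ G --> 0.
  rewrite -(_ : \sum_(n <- box K) (0 * 0 + 0 * 0) = 0); last first.
    by apply: big1 => n _; rewrite mul0r addr0.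
  apply: cvg_sum_seq => n; under eq_cvg do rewrite sqr_normRcomplex !expr2.
  have Re0 : (fun x : l2 R => complex.Re ((p - x : l2 R) n)) @ G --> 0.
    rewrite -(subrr (a n)); under eq_cvg do rewrite l2B_coord raddfB.
    by apply: cvgB; [exact: (cvg_cst (a n))|exact: Ga].
  have Im0 : (fun x : l2 R => complex.Im ((p - x : l2 R) n)) @ G --> 0.
    rewrite -(subrr (b n)); under eq_cvg do rewrite l2B_coord raddfB.
    by apply: cvgB; [exact: (cvg_cst (b n))|exact: Gb].
  by apply: cvgD; apply: cvgM; by [exact: Re0|exact: Im0].
have e2 : 0 < e ^+ 2 / 2 by rewrite divr_gt0// exprn_gt0.
near=> x.
rewrite -(@ltr_pXn2r _ 2)// ?nnegrE ?(ltW e0)//.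
have xK : `|x| ^+ 2 - boxsum K x <= e ^+ 2 / 8 by near: x.
apply: le_lt_trans (sqnormB_le pK xK) _.
have : boxsum K (p - x : l2 R) < e ^+ 2 / 2 by near: x; exact: (cvgr_lt _ Gd).
by lra.
Unshelve. all: by end_near. Qed.

End l2_coordinates.

(** * Gronwall's lemma and the flux of the discrete Laplacian *)

Lemma is_derive_sum_seq (R : realType) (I : Type) (r : seq I) (f : I -> R -> R)
    (df : I -> R) (t : R) :
  (forall i, is_derive t 1 (f i) (df i)) ->
  is_derive t 1 (fun s => \sum_(i <- r) f i s) (\sum_(i <- r) df i).
Proof.
move=> fdf; elim: r => [|i r IH].
  rewrite big_nil; under eq_fun do rewrite big_nil; exact: is_derive_cst.
rewrite big_cons; under eq_fun do rewrite big_cons.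
exact: is_deriveD.
Qed.

(** The function [exp (- a t) (f t + c / a)] is nonincreasing. The sign of [a] is left free:
    negative for dissipation, positive for comparing two solutions. *)
Lemma gronwall_affine (R : realType) (f df : R -> R) (a c T : R) :
  0 <= T -> a != 0 -> {within `[0, T], continuous f} ->
  (forall t, 0 < t < T -> is_derive t 1 f (df t)) ->
  (forall t, 0 < t < T -> df t <= a * f t + c) ->
  f T + c / a <= expR (a * T) * (f 0 + c / a).
Proof.
move=> T0 a0 cf fdf dfle.
pose h t := expR (- a * t) * (f t + c / a).
have hdh t : 0 < t < T ->
    is_derive t 1 h (expR (- a * t) * (df t - a * f t - c)).
  move=> /fdf ft.
  have e1 : is_derive t 1 (fun s => expR (- a * s)) (expR (- a * t) * - a).
    apply: (@is_derive1_comp R expR (fun s => - a * s)).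
    by apply: is_derive_eq; rewrite /GRing.scale/= mulr1.
  have e2 : is_derive t 1 (fun s => f s + c / a) (df t).
    by apply: is_derive_eq; rewrite addr0.
  apply: is_derive_eq; rewrite /GRing.scale/=; field; exact: a0.
have ch : {within `[0, T], continuous h}.
  move=> t; apply: cvgM; last by apply: cvgD; [exact: cf|exact: cvg_cst].
  apply: continuous_subspaceT => s; apply: continuous_comp.
    by apply: cvgM; [exact: cvg_cst|exact: cvg_id].
  exact: continuous_expR.
have : h T <= h 0.
  apply: (@ler0_derive1_nincr _ h 0 T) => // t; rewrite in_itv/= => tT.
    by have := hdh _ tT.
  have [_ dh] := hdh _ tT; rewrite derive1E dh.
  by rewrite mulr_ge0_le0 ?expR_ge0//; have := dfle _ tT; lra.
rewrite /h mulr0 expR0 mul1r mulNr expRN => hT.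
by rewrite -ler_pdivrMl ?expR_gt0.
Qed.

(** This is [Im (conj (u n) u (n + 1))], half the rate at which the Laplacian carries [|u|^2] from
    site [n + 1] to site [n]. *)
Definition current (R : realType) (u : int -> Rcomplex R) (n : int) : R :=
  complex.Re (u n) * complex.Im (u (n + 1)) - complex.Im (u n) * complex.Re (u (n + 1)).

Lemma sum_box_telescope (V : zmodType) N (F : int -> V) :
  \sum_(n <- box N) (F (n + 1) - F n) = F (N%:Z + 1) - F (- N%:Z).
Proof.
rewrite /box big_map.
have -> : iota 0 N.*2.+1 = index_iota 0 N.*2.+1 by rewrite /index_iota subn0.
rewrite (telescope_sumr_eq (fun k => F (k%:Z - N%:Z)))//; last first.
  by move=> k _; congr (F _ - _); lia.
by congr (F _ - F _); lia.
Qed.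

Section flux.
Context {R : realType}.
Implicit Types (w : int -> R) (x : l2 R).

Lemma normr_current_le (u : int -> Rcomplex R) n :
  `|current u n| <= 2^-1 * (`|u n| ^+ 2 + `|u (n + 1)| ^+ 2).
Proof.
rewrite /current !sqr_normRcomplex.
move: (u n) (u (n + 1)) => [a b] [c d] /=.
rewrite ler_norml; apply/andP; split.
  have := sqr_ge0 (a + d); have := sqr_ge0 (b - c); nra.
have := sqr_ge0 (a - d); have := sqr_ge0 (b + c); nra.
Qed.

(** Summation by parts moves the difference from the current to the weight; each [|x n|^2] then
    occurs at most twice, with factor [e / 2]. *)
Lemma flux_le x N w (e : R) : 
  (forall n, (N <= absz n)%N -> w n = 0) ->
  (forall n, `|w n - w (n + 1)| <= e) ->
  \sum_(n <- box N) w n * (current x n - current x (n - 1)) <= e * `|x| ^+ 2.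
Proof.
move=> w0 wlip; have e0 : 0 <= e := le_trans (normr_ge0 _) (wlip 0).
rewrite -[leLHS]addr0.
(* The boundary terms of this telescoping sum carry [w (N + 1)] and [w (- N)], both 0, so it may be
   added freely. *)
rewrite -[X in _ + X](_ : \sum_(n <- box N) (w (n + 1) * current x (n + 1 - 1) - w n * current x (n - 1)) * -1 = 0); last first.
  rewrite -mulr_suml (@sum_box_telescope _ N (fun n => w n * current x (n - 1))).
  by rewrite !w0 ?mul0r ?subrr ?mul0r//; lia.
rewrite -big_split/=.
apply: (@le_trans _ _ (\sum_(n <- box N) e * (2^-1 * (`|x n| ^+ 2 + `|x (n + 1)| ^+ 2)))).
  apply: ler_sum => n _; rewrite addrK.
  rewrite [leLHS](_ : _ = (w n - w (n + 1)) * current x n); last by ring.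
  apply: le_trans (ler_norm _) _; rewrite normrM.
  by apply: ler_pM => //; exact: normr_current_le.
rewrite -mulr_sumr ler_wpM2l// -mulr_sumr big_split/=.
have := sum_le_sqnorm x (box_uniq N).
have : uniq [seq n + 1 | n <- box N] by rewrite map_inj_uniq ?box_uniq// => i j /addIr.
by move=> /(sum_le_sqnorm x); rewrite big_map; lra.
Qed.

End flux.

(** * Weighted energies and coordinatewise solutions *)

Definition lap (R : realType) (u : int -> Rcomplex R) (n : int) : Rcomplex R :=
  u (n + 1) - 2 * u n + u (n - 1).

Section weighted_energy.
Context {R : realType}.
Implicit Types (w : int -> R) (u : int -> Rcomplex R).

Definition wsum w N u : R := \sum_(n <- box N) w n * `|u n| ^+ 2.

(** The left-hand side is [Im (conj (u n) lap u n)]; the diagonal term contributes the real number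
    [- 2 |u n|^2] and drops out. *)
Lemma lap_current u n :
  complex.Re (u n) * complex.Im (lap u n) - complex.Im (u n) * complex.Re (lap u n) =
  current u n - current u (n - 1).
Proof.
rewrite /lap /current subrK mulr_natl mulr2n !raddfD/= !raddfN/=; ring.
Qed.

(** [P] and [Q] are the real and imaginary parts of the vector field without the Laplacian; kept
    abstract, they serve for one solution and for a difference of two. The Laplacian costs only the
    flux [2 e M] before Gronwall's lemma is applied. *)
Lemma weighted_energy_le (x : R -> l2 R) (P Q : R -> int -> R) T a C M e w N :
  0 <= T -> a != 0 ->
  (forall n, {within `[0, T], continuous (fun t => complex.Re (x t n))}) ->
  (forall n, {within `[0, T], continuous (fun t => complex.Im (x t n))}) ->
  (forall t n, 0 < t < T ->
    is_derive t 1 (fun s => complex.Re (x s n)) (complex.Im (lap (x t) n) + P t n)) ->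
  (forall t n, 0 < t < T ->
    is_derive t 1 (fun s => complex.Im (x s n)) (- complex.Re (lap (x t) n) + Q t n)) ->
  (forall t, 0 < t < T -> `|x t| ^+ 2 <= M) ->
  (forall n, (N <= absz n)%N -> w n = 0) ->
  (forall n, `|w n - w (n + 1)| <= e) ->
  (forall t, 0 < t < T ->
     \sum_(n <- box N) w n *
       (2 * (complex.Re (x t n) * P t n + complex.Im (x t n) * Q t n)) <=
     a * wsum w N (x t) + C) ->
  wsum w N (x T) + (2 * e * M + C) / a <=
  expR (a * T) * (wsum w N (x 0) + (2 * e * M + C) / a).
Proof.
move=> T0 a0 cRe cIm dRe dIm xM w0 wlip PQ.
have e0 : 0 <= e := le_trans (normr_ge0 _) (wlip 0).
have wE t : wsum w N (x t) = \sum_(n <- box N) w n *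
    (complex.Re (x t n) * complex.Re (x t n) + complex.Im (x t n) * complex.Im (x t n)).
  by apply: eq_bigr => n _; rewrite sqr_normRcomplex !expr2.
pose dE t n := w n * (2 * (complex.Re (x t n) * (complex.Im (lap (x t) n) + P t n) +
   complex.Im (x t n) * (- complex.Re (lap (x t) n) + Q t n))).
apply: (@gronwall_affine _ (fun t => wsum w N (x t)) (fun t => \sum_(n <- box N) dE t n)) => //.
- rewrite (funext wE).
  move=> t; apply: cvg_sum_seq => n; apply: cvgM; first exact: cvg_cst.
  by apply: cvgD; apply: cvgM; by [exact: cRe|exact: cIm].
- move=> t tT; rewrite (funext wE).
  apply: is_derive_sum_seq => n.
  have := dRe t n tT; have := dIm t n tT => dI dR.
  by apply: is_derive_eq; rewrite /dE /GRing.scale/=; ring.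
- move=> t tT; have := PQ t tT; have := flux_le (x t) w0 wlip.
  have := xM t tT => /(ler_wpM2l e0).
  rewrite (_ : \sum_(n <- box N) dE t n =
    2 * (\sum_(n <- box N) w n * (current (x t) n - current (x t) (n - 1))) +
    \sum_(n <- box N) w n *
       (2 * (complex.Re (x t n) * P t n + complex.Im (x t n) * Q t n))); first by lra.
  rewrite mulr_sumr -big_split; apply: eq_bigr => n _ /=.
  by rewrite -lap_current /dE; ring.
Qed.

End weighted_energy.

Section weak_solutions.
Context {R : realType}.
Implicit Types (delta gamma : R) (g u : l2 R) (phi : R -> l2 R).

(* Only the coordinates are required to be differentiable, and only at positive
   times, so that the notion is visibly invariant under time shifts. *)
Definition weak_solution delta gamma g phi : Prop :=
  [/\ phi t @[t --> 0^'+] --> phi 0,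
      forall t : R, 0 < t -> phi s @[s --> t] --> phi t,
      forall (t : R) n, 0 < t -> is_derive t 1 (fun s => complex.Re (phi s n))
        (complex.Im (lap (phi t) n) +
         (gamma * `|phi t n| ^+ 2 * complex.Im (phi t n)
          - delta * complex.Re (phi t n) + complex.Im (g n))) &
      forall (t : R) n, 0 < t -> is_derive t 1 (fun s => complex.Im (phi s n))
        (- complex.Re (lap (phi t) n) +
         - (gamma * `|phi t n| ^+ 2 * complex.Re (phi t n)
            + delta * complex.Im (phi t n) + complex.Re (g n)))].

(** The map [f] stands for [complex.Re] or [complex.Im]. *)
Lemma cvg_coord (T : Type) (F : set_system T) (x : T -> l2 R) (y : l2 R)
    (f : {linear Rcomplex R -> R}) n {FF : Filter F} :
  (forall z, `|f z| <= `|z|) -> x t @[t --> F] --> y ->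
  f (x t n) @[t --> F] --> f (y n).
Proof.
move=> fle /cvgrPdist_lt xy; apply/cvgrPdist_lt => e /xy.
apply: filterS => t; apply: le_lt_trans.
by rewrite -raddfB (le_trans (fle _))// (coord_le (y - x t)).
Qed.

Lemma is_derive_coord (x : R -> l2 R) (dx : l2 R) t
    (f : {linear Rcomplex R -> R}) n :
  (forall z, `|f z| <= `|z|) -> 
  h^-1 *: (x (t + h) - x t) @[h --> 0^'] --> dx ->
  is_derive t 1 (fun s => f (x s n)) (f (dx n)).
Proof.
move=> fle xdx; have cf := @cvg_coord _ _ _ _ f n _ fle xdx.
have cf' : h^-1 *: (f (x (h *: 1 + t) n) - f (x t n)) @[h --> 0^'] --> f (dx n).
  rewrite (_ : (fun _ => _) = fun h => f ((h^-1 *: (x (t + h) - x t) : l2 R) n)).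
  exact: cf.
  apply/funext => h; rewrite l2Z_coord l2B_coord -(raddfB f) linearZ /= [h%:A]mulr1 (addrC t)//.
split; first by apply/cvg_ex; exists (f (dx n)).
exact: cvg_lim cf'.
Qed.

Lemma dfDNLS_coord delta gamma g (x y : l2 R) n :
  ('i%C : Rcomplex R) * y n =
    (x (n + 1) - 2 * x n + x (n - 1)) + (gamma * `|x n| ^+ 2) *: x n
    - ('i%C : Rcomplex R) * (delta *: x n) + g n ->
  complex.Re (y n) = complex.Im (lap x n) +
         (gamma * `|x n| ^+ 2 * complex.Im (x n)
          - delta * complex.Re (x n) + complex.Im (g n)) /\
  complex.Im (y n) = - complex.Re (lap x n) +
         - (gamma * `|x n| ^+ 2 * complex.Re (x n)
            + delta * complex.Im (x n) + complex.Re (g n)).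
Proof.
have Rei (z : Rcomplex R) : complex.Re (('i%C : Rcomplex R) * z) = - complex.Im z.
  by case: z => a b; rewrite /GRing.mul/= mul0r mul1r sub0r.
have Imi (z : Rcomplex R) : complex.Im (('i%C : Rcomplex R) * z) = complex.Re z.
  by case: z => a b; rewrite /GRing.mul/= mul0r mul1r add0r.
rewrite -/(lap x n) => eqn; split.
  rewrite -Imi eqn !raddfD/= !raddfN/= Imi !linearZ/=; ring.
rewrite -[LHS]opprK -Rei eqn !raddfD/= !raddfN/= Rei !linearZ/=; ring.
Qed.
End weak_solutions.

(** * Solutions are weak solutions; bounds and time shifts *)

Section solutions_are_weak.
Context {R : realType}.
Implicit Types (delta gamma : R) (g u : l2 R) (phi : R -> l2 R).

Lemma near_dnbhs0P (P : set R) :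
  (\forall h \near 0^', P h) <->
  exists2 d, 0 < d & forall h, `|h| < d -> h != 0 -> P h.
Proof.
split=> [/nbhs_ballP[d /= d0 dP]|[d d0 dP]].
  by exists d => // h hd; apply: dP; rewrite -ball_normE/= sub0r normrN.
by apply/nbhs_ballP; exists d => //= h; rewrite -ball_normE/= sub0r normrN; apply: dP.
Qed.

(** Near 0 the difference quotient has norm at most [|dx| + 1]. Continuity of solutions follows, at
    positive times and from the right at 0. *)
Lemma diff_quotient_lipschitz (V : normedModType R) (x : R -> V) (dx : V) t (D : set R) :
  h^-1 *: (x (t + h) - x t) @[h --> within D 0^'] --> dx ->
  exists2 d, 0 < d & exists2 C, 0 < C &
    forall h, `|h| < d -> D h -> `|x (t + h) - x t| <= `|h| * C.
Proof.
move=> /cvgrPdist_lt/(_ _ ltr01)/near_dnbhs0P[d d0 dq].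
exists d => //; exists (`|dx| + 1); first by rewrite ltr_wpDl.
move=> h hd Dh; have [->|h0] := eqVneq h 0.
  by rewrite addr0 subrr !normr0 mul0r.
have /ltW := dq h hd h0 Dh.
rewrite -[X in `|X| <= _ * _](scale1r) -(divff h0) -scalerA normrZ.
move=> q1; apply: ler_wpM2l => //.
set q := _^-1 *: _ in q1 *.
by rewrite -[q](subKr dx) (le_trans (ler_normB _ _))// lerD2l.
Qed.

Lemma dfDNLS_solution_weak delta gamma g (phi0 : l2 R) phi :
  dfDNLS_solution delta gamma g phi0 phi -> weak_solution delta gamma g phi.
Proof.
case=> phi00 [dphi [_ dphiE] eqn].
have dphi_pos t : 0 < t -> h^-1 *: (phi (t + h) - phi t) @[h --> 0^'] --> dphi t.
  move=> t0; apply/cvgrPdist_lt => e e0.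
  have /cvgrPdist_lt/(_ _ e0)/near_dnbhs0P[d d0 dq] := dphiE t (ltW t0).
  (* For [|h| < t] the constraint [0 <= t + h] holds, so at positive times the derivative is
     two-sided. *)
  apply/near_dnbhs0P; exists (Num.min d t); first by rewrite lt_min d0.
  move=> h; rewrite lt_min => /andP[hd ht] h0; apply: dq => //=.
  by move: ht; rewrite ltr_norml => /andP[+ _]; lra.
have cphi_pos (t : R) : 0 < t -> phi s @[s --> t] --> phi t.
  move=> t0; apply/cvgrPdist_lt => e e0.
  have [d d0 [C C0 dC]] := diff_quotient_lipschitz (dphiE t (ltW t0)).
  apply/nbhs_ballP; exists (Num.min (Num.min d t) (e / C)).
    by rewrite /= !lt_min d0 t0 divr_gt0.
  move=> s /=; rewrite !lt_min distrC => /andP[/andP[sd st] se].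
  have := dC _ sd; rewrite /= addrC subrK distrC => dCs.
  apply: le_lt_trans (dCs _) _.
    by move: st; rewrite ltr_norml => /andP[+ _]; lra.
  by rewrite -ltr_pdivlMr.
have cphi0 : phi t @[t --> 0^'+] --> phi 0.
  apply/cvgrPdist_lt => e e0.
  have [d d0 [C C0 dC]] := diff_quotient_lipschitz (dphiE 0 (lexx 0)).
  apply/nbhs_ballP; exists (Num.min d (e / C)).
    by rewrite /= !lt_min d0 divr_gt0.
  move=> s; rewrite -ball_normE/= !lt_min sub0r normrN => /andP[sd se] s0.
  have := dC _ sd; rewrite /= add0r distrC => dCs.
  apply: le_lt_trans (dCs (ltW s0)) _.
  by rewrite -ltr_pdivlMr.
split=> //.
- move=> t n t0; have [<- _] := dfDNLS_coord (eqn t (ltW t0) n).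
  exact: (is_derive_coord _ (@normr_Re_le R) (dphi_pos t t0)).
- move=> t n t0; have [_ <-] := dfDNLS_coord (eqn t (ltW t0) n).
  exact: (is_derive_coord _ (@normr_Im_le R) (dphi_pos t t0)).
Qed.

(** A non-explicit bound is enough where it multiplies a flux error that vanishes as the cutoff
    widens, or where two solutions start from the same point. *)
Lemma weak_solution_bounded delta gamma g phi T :
  weak_solution delta gamma g phi -> exists M, forall t, 0 <= t <= T -> `|phi t| <= M.
Proof.
move=> [phi0 phit _ _]; have [T0|T0] := ltP 0 T; last first.
  exists `|phi 0| => t /andP[t0 tT].
  by rewrite (_ : t = 0)//; apply/eqP; rewrite eq_le t0 (le_trans tT).
have cN : {within `[0, T], continuous (fun t => `|phi t|)}.
  apply/continuous_within_itvP => //; split.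
  + move=> t; rewrite in_itv/= => /andP[t0 _].
    by apply: cvg_norm; exact: phit.
  + exact: cvg_norm.
  + by apply: cvg_norm; apply: cvg_at_left_filter; exact: phit.
have [c _ cM] := EVT_max (ltW T0) cN.
by exists `|phi c| => t tT; apply: cM; rewrite in_itv.
Qed.

Lemma weak_solution_coord_continuous delta gamma g phi T
    (f : {linear Rcomplex R -> R}) n : 0 <= T -> (forall z, `|f z| <= `|z|) ->
  weak_solution delta gamma g phi ->
  {within `[0, T], continuous (fun t => f (phi t n))}.
Proof.
move=> + fle [phi0 phit _ _]; rewrite le_eqVlt => /predU1P[<-|T0].
  by rewrite set_itv1; exact: continuous_subspace1.
apply/continuous_within_itvP => //; split.
- move=> t; rewrite in_itv/= => /andP[t0 _].
  by apply: cvg_coord => //; exact: phit.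
- exact: cvg_coord.
- by apply: cvg_coord => //; apply: cvg_at_left_filter; exact: phit.
Qed.

Lemma is_derive_comp_shift (f : R -> R) (t s df : R) :
  is_derive (t + s) 1 f df -> is_derive t 1 (fun v => f (v + s)) df.
Proof.
move=> fdf; rewrite -[df]mulr1.
apply: (@is_derive1_comp R f (fun v => v + s)).
by apply: is_derive_eq; rewrite addr0.
Qed.

(** Needed for the semigroup law, where a shifted orbit is compared with the orbit restarted at the
    same point. *)
Lemma weak_solution_shift delta gamma g phi s : 0 <= s ->
  weak_solution delta gamma g phi ->
  weak_solution delta gamma g (fun t => phi (t + s)).
Proof.
move=> s0 [phi0 phit dRe dIm].
have cts t : 0 < t + s -> phi (v + s) @[v --> t] --> phi (t + s).
  move=> ts0; apply: (@cvg_comp _ _ _ (fun v => v + s) phi _ _ _ _ (phit _ ts0)).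
  by apply: cvgD; [exact: cvg_id|exact: cvg_cst].
split.
- move: s0; rewrite le_eqVlt => /predU1P[<-|s0].
    by under eq_fun do rewrite addr0; rewrite addr0.
  by apply: cvg_at_right_filter; apply: cts; rewrite add0r.
- by move=> t t0; apply: cts; rewrite ltr_wpDr.
- move=> t n t0; have := dRe (t + s) n (ltr_wpDr s0 t0).
  exact: (@is_derive_comp_shift (fun v => complex.Re (phi v n))).
- move=> t n t0; have := dIm (t + s) n (ltr_wpDr s0 t0).
  exact: (@is_derive_comp_shift (fun v => complex.Im (phi v n))).
Qed.

End solutions_are_weak.

(** * Slowly varying cutoffs *)

Section cutoffs.
Context {R : realType}.

(** For [K > 0], a trapezoid: 1 up to [|n| = K], 0 from [|n| = 2 K] on, of slope [1 / K] in
    between. *)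
Definition cutoff (K : nat) (n : int) : R :=
  Num.max 0 (Num.min 1 (2 - (absz n)%:R / K%:R)).

Lemma cutoff_ge0 K n : 0 <= cutoff K n.
Proof. by rewrite /cutoff le_max lexx. Qed.

Lemma cutoff_le1 K n : cutoff K n <= 1.
Proof. by rewrite /cutoff ge_max ler01 ge_min lexx. Qed.

Lemma cutoff1 K n : (0 < K)%N -> (absz n <= K)%N -> cutoff K n = 1.
Proof.
move=> K0 nK; rewrite /cutoff min_l ?max_r//.
have : (absz n)%:R / K%:R <= 1 :> R by rewrite ler_pdivrMr ?ltr0n// mul1r ler_nat.
by lra.
Qed.

Lemma cutoff0 K n : (0 < K)%N -> (K.*2 <= absz n)%N -> cutoff K n = 0.
Proof.
move=> K0 nK; rewrite /cutoff max_l// ge_min; apply/orP; right.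
have : 2 <= (absz n)%:R / K%:R :> R.
  by rewrite ler_pdivlMr ?ltr0n// -natrM ler_nat mul2n.
by lra.
Qed.

Lemma cutoff_mono K N n : (0 < K)%N -> (K <= N)%N -> cutoff K n <= cutoff N n.
Proof.
move=> K0 KN; rewrite /cutoff ge_max !le_max lexx /=; apply/orP; right.
rewrite le_min !ge_min lexx /=; apply/orP; right.
rewrite lerD2l lerN2 ler_wpM2l// lef_pV2 ?ler_nat// posrE ltr0n//.
exact: leq_trans KN.
Qed.

Lemma cutoff_lip K n : (0 < K)%N -> `|cutoff K n - cutoff K (n + 1)| <= K%:R^-1.
Proof.
move=> K0; rewrite /cutoff.
have k0 : 0 <= K%:R^-1 :> R by rewrite invr_ge0.
have h1 : (absz n)%:R / K%:R <= (absz (n + 1))%:R / K%:R + K%:R^-1 :> R.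
  rewrite -[X in _ <= _ + X]mul1r -mulrDl ler_wpM2r// natr1 ler_nat; lia.
have h2 : (absz (n + 1))%:R / K%:R <= (absz n)%:R / K%:R + K%:R^-1 :> R.
  rewrite -[X in _ <= _ + X]mul1r -mulrDl ler_wpM2r// natr1 ler_nat; lia.
rewrite ler_norml; apply/andP; split;
  case: (leP 1 (2 - (absz n)%:R / K%:R : R)) => ?;
  case: (leP 1 (2 - (absz (n + 1))%:R / K%:R : R)) => ?;
  by rewrite !maxEle; do ?[case: ifPn; rewrite -?ltNge => ?]; lra.
Qed.

Lemma le_of_forall_invn (x y c : R) :
  (forall N : nat, x <= y + c / N.+1%:R) -> x <= y.
Proof.
move=> H; rewrite leNgt; apply/negP => yx.
have xy : 0 < x - y by rewrite subr_gt0.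
have := archi_boundP (divr_ge0 (normr_ge0 c) (ltW xy)).
set N := Num.bound _; rewrite ltr_pdivrMr// => cN.
have := H N; rewrite -lerBlDl ler_pdivlMr ?ltr0n// -natr1.
by have := ler_norm c; lra.
Qed.

End cutoffs.

(** * Comparison of cutoff sums with norms and tails *)

Section weighted_sums.
Context {R : realType}.
Implicit Types (u : int -> Rcomplex R) (x : l2 R) (w : int -> R).

Lemma boxsum_le_wsum N u : (0 < N)%N -> boxsum N u <= wsum (cutoff N) N.*2 u.
Proof.
move=> N0; have NN : (N <= N.*2)%N by lia.
rewrite /boxsum (big_box_sub _ _ NN) big_mkcond; apply: ler_sum => n _.
case: ifPn => [nN|_]; last by rewrite mulr_ge0 ?cutoff_ge0 ?sqr_ge0.
by rewrite cutoff1// mul1r.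
Qed.

Lemma wsum_cutoff_le N x : wsum (cutoff N) N.*2 x <= `|x| ^+ 2.
Proof.
apply: le_trans (boxsum_le_sqnorm N.*2 x); apply: ler_sum => n _.
by rewrite ler_piMl ?sqr_ge0// cutoff_le1.
Qed.

(** For [0 < K] and [2 K <= N] it vanishes up to [K], equals 1 from [2 K] to [N] and vanishes again
    from [2 N] on: it selects a tail while keeping finite support. *)
Definition tail_cutoff (K N : nat) (n : int) : R := cutoff N n - cutoff K n.

Lemma boxsumB_le_wsum K N u : (0 < K)%N -> (K.*2 <= N)%N ->
  boxsum N u - boxsum K.*2 u <= wsum (tail_cutoff K N) N.*2 u.
Proof.
move=> K0 KN; have NN : (N <= N.*2)%N by lia.
rewrite boxsumB// [leLHS]big_mkcond (big_box_sub _ _ NN) big_mkcond.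
apply: ler_sum => n _; have KN' : (K <= N)%N by lia.
have w0 : 0 <= tail_cutoff K N n * `|u n| ^+ 2.
  by rewrite mulr_ge0 ?sqr_ge0// subr_ge0 cutoff_mono.
case: ifPn => // nN; case: ifPn => // nK.
by rewrite /tail_cutoff cutoff1//; [rewrite cutoff0 ?subr0 ?mul1r//; lia|lia].
Qed.

Lemma wsum_tail_cutoff_le K N x : (0 < K)%N -> (K <= N)%N ->
  wsum (tail_cutoff K N) N.*2 x <= `|x| ^+ 2 - boxsum K x.
Proof.
move=> K0 KN; have KN2 : (K <= N.*2)%N by lia.
apply: (@le_trans _ _ (boxsum N.*2 x - boxsum K x)); last first.
  by rewrite lerD2r boxsum_le_sqnorm.
rewrite boxsumB// [leRHS]big_mkcond; apply: ler_sum => n _.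
case: ifPn => [nK|]; last rewrite negbK => nK.
  apply: ler_piMl; rewrite ?sqr_ge0// /tail_cutoff.
  by have := @cutoff_le1 R N n; have := @cutoff_ge0 R K n; lra.
by rewrite /tail_cutoff !cutoff1 ?subrr ?mul0r//; lia.
Qed.

Lemma tail_cutoff_lip K N n : (0 < K)%N -> (K <= N)%N ->
  `|tail_cutoff K N n - tail_cutoff K N (n + 1)| <= 2 / K%:R.
Proof.
move=> K0 KN; have N0 : (0 < N)%N by lia.
rewrite (_ : _ - _ = (cutoff N n - cutoff N (n + 1)) - (cutoff K n - cutoff K (n + 1))).
  apply: le_trans (ler_normB _ _) _.
  rewrite mulr_natl mulr2n; apply: lerD; last exact: cutoff_lip.
  apply: le_trans (cutoff_lip _ N0) _.
  by rewrite lef_pV2 ?ler_nat// posrE ltr0n.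
by rewrite /tail_cutoff; ring.
Qed.

End weighted_sums.

(** * A priori estimates *)

Section estimates.
Context {R : realType}.
Implicit Types (delta gamma T : R) (g u : l2 R) (phi psi : R -> l2 R) (w : int -> R).

(** Half of the damping absorbs the forcing, by completing squares; [a], [b] are the coordinates of
    the solution and [c], [d] those of [g]. *)
Lemma damped_forcing_le delta (a b c d : R) : 0 < delta ->
  2 * (a * (- delta * a + d) + b * - (delta * b + c)) <=
  - delta * (a ^+ 2 + b ^+ 2) + delta^-1 * (c ^+ 2 + d ^+ 2).
Proof.
move=> d0; rewrite -subr_ge0.
rewrite (_ : _ - _ = delta * ((a - d / delta) ^+ 2 + (b + c / delta) ^+ 2)).
  by apply: mulr_ge0; [exact: ltW|rewrite addr_ge0 ?sqr_ge0].
by field; rewrite gt_eqF.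
Qed.

Lemma weak_solution_wsum_le delta gamma g phi T M e w N :
  0 < delta -> weak_solution delta gamma g phi -> 0 <= T ->
  (forall t, 0 <= t <= T -> `|phi t| ^+ 2 <= M) ->
  (forall n, 0 <= w n) ->
  (forall n, (N <= absz n)%N -> w n = 0) ->
  (forall n, `|w n - w (n + 1)| <= e) ->
  wsum w N (phi T) <= expR (- delta * T) * wsum w N (phi 0) +
    (2 * e * M + delta^-1 * wsum w N g) / delta.
Proof.
move=> d0 wphi T0 phiM w0 wN wlip.
have [_ _ dRe dIm] := wphi.
have M0 : 0 <= M by apply: le_trans (phiM 0 _); rewrite ?sqr_ge0// lexx.
have e0 : 0 <= e := le_trans (normr_ge0 _) (wlip 0).
have g0 : 0 <= wsum w N g by apply: sumr_ge0 => n _; rewrite mulr_ge0 ?sqr_ge0.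
have := @weighted_energy_le R phi _ _ T (- delta) (delta^-1 * wsum w N g) M e w N T0 _
  (fun n => weak_solution_coord_continuous T0 (@normr_Re_le R) wphi)
  (fun n => weak_solution_coord_continuous T0 (@normr_Im_le R) wphi)
  (fun t n tT => dRe t n (proj1 (andP tT))) (fun t n tT => dIm t n (proj1 (andP tT))).
rewrite oppr_eq0 gt_eqF// => /(_ isT) H.
have phiM' t : 0 < t < T -> `|phi t| ^+ 2 <= M.
  by move=> /andP[t0 tT]; apply: phiM; rewrite !ltW.
have {H} := H phiM' wN wlip.
set C := 2 * e * M + _.
have C0 : 0 <= C / delta.
  apply: divr_ge0; last exact: ltW.
  by apply: addr_ge0; rewrite !mulr_ge0// invr_ge0 ltW.
have E0 : 0 <= expR (- delta * T) by exact: expR_ge0.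
rewrite invrN mulrN => H.
have {H} : wsum w N (phi T) - C / delta <=
   expR (- delta * T) * (wsum w N (phi 0) - C / delta).
  apply: H => t tT.
  rewrite /wsum !mulr_sumr -big_split; apply: ler_sum => n _ /=.
  rewrite [_ * (w n * _)]mulrCA [delta^-1 * _]mulrCA -mulrDr ler_wpM2l//.
  (* Paired with the solution, the two cubic terms cancel; only damping and forcing remain. *)
  rewrite !sqr_normRcomplex.
  have := damped_forcing_le (complex.Re (phi t n)) (complex.Im (phi t n))
    (complex.Re (g n)) (complex.Im (g n)) d0.
  lra.
(* The rate [- delta] puts [- C / delta] on both sides of Gronwall's bound; its exponentially
   weighted copy on the right is nonpositive and is dropped. *)
have := mulr_ge0 E0 C0; lra.
Qed.

Lemma weak_solution_sqnorm_le delta gamma g phi T :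
  0 < delta -> weak_solution delta gamma g phi -> 0 <= T ->
  `|phi T| ^+ 2 <= expR (- delta * T) * `|phi 0| ^+ 2 + (`|g| / delta) ^+ 2.
Proof.
move=> d0 wphi T0; have [M phiM] := weak_solution_bounded T wphi.
have phiM2 t : 0 <= t <= T -> `|phi t| ^+ 2 <= M ^+ 2.
  by move=> /phiM H; rewrite lerXn2r// nnegrE// (le_trans _ H).
apply: sqnorm_le => K.
(* The cutoff scale is the maximum of [L + 1] and [K]: large enough to cover the box [K] and to make
   the flux error at most [2 M^2 / delta / (L + 1)]. *)
apply: (@le_of_forall_invn _ _ _ (2 * M ^+ 2 / delta)) => L.
have LN : (L.+1 <= maxn L.+1 K)%N by rewrite leq_maxl.
have N0 : (0 < maxn L.+1 K)%N by apply: leq_trans LN.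
have KN : (K <= maxn L.+1 K)%N by rewrite leq_maxr.
move: (maxn _ _) LN N0 KN => N LN N0 KN.
apply: le_trans (boxsum_mono _ KN) _.
apply: le_trans (boxsum_le_wsum _ N0) _.
apply: le_trans (weak_solution_wsum_le d0 wphi T0 phiM2 (cutoff_ge0 N)
  (fun n => @cutoff0 _ N n N0) (fun n => cutoff_lip n N0)) _.
have E1 : expR (- delta * T) * wsum (cutoff N) N.*2 (phi 0) <=
    expR (- delta * T) * `|phi 0| ^+ 2.
  by rewrite ler_wpM2l ?expR_ge0// wsum_cutoff_le.
have G1 : delta^-1 * wsum (cutoff N) N.*2 g / delta <= (`|g| / delta) ^+ 2.
  rewrite exprMn mulrAC [leRHS]mulrC -expr2 ler_wpM2l ?sqr_ge0//.
  exact: wsum_cutoff_le.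
have L1 : 2 * N%:R^-1 * M ^+ 2 / delta <= 2 * M ^+ 2 / delta / L.+1%:R.
  rewrite -[leLHS]mulrA mulrAC mulrA ler_wpM2l//.
    by apply: divr_ge0; [rewrite mulr_ge0 ?sqr_ge0|exact: ltW].
  by rewrite lef_pV2 ?ler_nat// posrE ltr0n.
rewrite -addrA; apply: lerD => //; rewrite mulrDl addrC; exact: lerD.
Qed.

(** The flux constant [2 / K] of the tail cutoff does not depend on its outer scale [N], so the
    bound covers the whole tail. For fixed [M] the part without the exponential tends to 0 as [K]
    grows. *)
Lemma weak_solution_tail_le delta gamma g phi T M K :
  0 < delta -> weak_solution delta gamma g phi -> 0 <= T -> (0 < K)%N ->
  (forall t, 0 <= t <= T -> `|phi t| ^+ 2 <= M) ->
  `|phi T| ^+ 2 - boxsum K.*2 (phi T) <=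
  expR (- delta * T) * `|phi 0| ^+ 2 +
    (2 * (2 / K%:R) * M + delta^-1 * (`|g| ^+ 2 - boxsum K g)) / delta.
Proof.
move=> d0 wphi T0 K0 phiM; rewrite lerBlDr; apply: sqnorm_le => L.
have LN : (L <= maxn L K.*2)%N by rewrite leq_maxl.
have KN : (K.*2 <= maxn L K.*2)%N by rewrite leq_maxr.
move: (maxn _ _) LN KN => N LN KN2.
apply: le_trans (boxsum_mono _ LN) _; rewrite -lerBlDr.
have KN : (K <= N)%N by lia.
have N0 : (0 < N)%N by lia.
apply: le_trans (boxsumB_le_wsum _ K0 KN2) _.
have wN n : (N.*2 <= absz n)%N -> tail_cutoff K N n = 0 :> R.
  by move=> nN; rewrite /tail_cutoff !cutoff0 ?subrr//; lia.
have w0 n : 0 <= tail_cutoff K N n :> R by rewrite subr_ge0 cutoff_mono.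
apply: le_trans (weak_solution_wsum_le d0 wphi T0 phiM w0 wN
  (fun n => tail_cutoff_lip n K0 KN)) _.
apply: lerD.
  rewrite ler_wpM2l ?expR_ge0//; apply: le_trans (wsum_tail_cutoff_le _ K0 KN) _.
  by rewrite lerBlDr lerDl sumr_ge0// => n _; exact: sqr_ge0.
rewrite ler_wpM2r ?invr_ge0 ?(ltW d0)// lerD2l ler_wpM2l ?invr_ge0 ?(ltW d0)//.
exact: wsum_tail_cutoff_le.
Qed.

(* The contributions of [|z1|^2 * a * b] cancel: the left-hand side is
   [(|z1|^2 - |z2|^2) * (a * Im z2 - b * Re z2)] in absolute value. *)
Lemma cubic_difference_le (z1 z2 : Rcomplex R) (M : R) :
  `|z1| <= M -> `|z2| <= M ->
  let a := complex.Re z1 - complex.Re z2 in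
  let b := complex.Im z1 - complex.Im z2 in
  `|a * (`|z1| ^+ 2 * complex.Im z1 - `|z2| ^+ 2 * complex.Im z2) -
    b * (`|z1| ^+ 2 * complex.Re z1 - `|z2| ^+ 2 * complex.Re z2)| <=
  4 * M ^+ 2 * (a ^+ 2 + b ^+ 2).
Proof.
move=> z1M z2M; rewrite !sqr_normRcomplex.
have [a1 b1 a2 b2] : [/\ `|complex.Re z1| <= M, `|complex.Im z1| <= M,
    `|complex.Re z2| <= M & `|complex.Im z2| <= M].
  split; [apply: le_trans z1M|apply: le_trans z1M|apply: le_trans z2M|apply: le_trans z2M];
    by [exact: normr_Re_le|exact: normr_Im_le].
move: z1 z2 {z1M z2M} a1 b1 a2 b2 => [x1 y1] [x2 y2] /= X1 Y1 X2 Y2.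
have M0 : 0 <= M := le_trans (normr_ge0 _) X1.
set a := x1 - x2; set b := y1 - y2.
rewrite (_ : _ - _ = (a * (x1 + x2) + b * (y1 + y2)) * (a * y2 - b * x2)); last first.
  by rewrite /a /b; ring.
rewrite normrM.
apply: (@le_trans _ _ ((2 * M * (`|a| + `|b|)) * (M * (`|a| + `|b|)))).
  apply: ler_pM => //.
    apply: le_trans (ler_normD _ _) _; rewrite !normrM mulrDr [leRHS]addrC addrC.
    apply: lerD; rewrite mulrC ler_wpM2r//; apply: le_trans (ler_normD _ _) _; lra.
  apply: le_trans (ler_normB _ _) _; rewrite !normrM mulrDr.
  by apply: lerD; rewrite mulrC ler_wpM2r.
have : (`|a| + `|b|) ^+ 2 <= 2 * (a ^+ 2 + b ^+ 2).
  rewrite -[a ^+ 2]real_normK ?num_real// -[b ^+ 2]real_normK ?num_real//.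
  by have := sqr_ge0 (`|a| - `|b|); lra.
by move=> /(ler_wpM2l (mulr_ge0 (ler0n R 2) (sqr_ge0 M))); lra.
Qed.

(** In the difference of two solutions the forcing cancels and the damping has a favourable sign, so
    only the cubic term drives growth. *)
Lemma weak_solution_lipschitz delta gamma g phi psi T M :
  0 < delta -> weak_solution delta gamma g phi -> weak_solution delta gamma g psi ->
  0 <= T -> (forall t, 0 <= t <= T -> `|phi t| <= M) ->
  (forall t, 0 <= t <= T -> `|psi t| <= M) ->
  `|phi T - psi T| ^+ 2 <=
  expR ((8 * `|gamma| * M ^+ 2 + 1) * T) * `|phi 0 - psi 0| ^+ 2.
Proof.
move=> d0 wphi wpsi T0 phiM psiM.
have [_ _ dRe1 dIm1] := wphi; have [_ _ dRe2 dIm2] := wpsi.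
(* The 8 is twice the constant of [cubic_difference_le]; the added 1 keeps the rate positive even
   for [gamma = 0], since Gronwall's lemma divides by it. *)
set a := 8 * _ * _ + 1.
have a0 : 0 < a.
  by apply: ltr_wpDl => //; apply: mulr_ge0; [exact: mulr_ge0|exact: sqr_ge0].
pose x t := phi t - psi t.
pose P t n := gamma * (`|phi t n| ^+ 2 * complex.Im (phi t n) -
  `|psi t n| ^+ 2 * complex.Im (psi t n)) - delta * complex.Re (x t n).
pose Q t n := - gamma * (`|phi t n| ^+ 2 * complex.Re (phi t n) -
  `|psi t n| ^+ 2 * complex.Re (psi t n)) - delta * complex.Im (x t n).
have xlap t n : lap (x t) n = lap (phi t) n - lap (psi t) n.
  by rewrite /lap /x !l2B_coord; ring.
have cRe n : {within `[0, T], continuous (fun t => complex.Re (x t n))}.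
  rewrite (_ : (fun _ => _) = fun t => complex.Re (phi t n) - complex.Re (psi t n)).
    move=> t; apply: cvgB.
      exact: (weak_solution_coord_continuous T0 (@normr_Re_le R) wphi).
    exact: (weak_solution_coord_continuous T0 (@normr_Re_le R) wpsi).
  by apply/funext => t; rewrite l2B_coord raddfB.
have cIm n : {within `[0, T], continuous (fun t => complex.Im (x t n))}.
  rewrite (_ : (fun _ => _) = fun t => complex.Im (phi t n) - complex.Im (psi t n)).
    move=> t; apply: cvgB.
      exact: (weak_solution_coord_continuous T0 (@normr_Im_le R) wphi).
    exact: (weak_solution_coord_continuous T0 (@normr_Im_le R) wpsi).
  by apply/funext => t; rewrite l2B_coord raddfB.
have dRe t n : 0 < t < T -> is_derive t 1 (fun s => complex.Re (x s n))
    (complex.Im (lap (x t) n) + P t n).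
  move=> /andP[t0 _]; have := dRe1 t n t0; have := dRe2 t n t0 => D2 D1.
  rewrite (_ : (fun _ => _) = (fun t => complex.Re (phi t n)) - (fun t => complex.Re (psi t n))).
    by apply: is_derive_eq; rewrite xlap /P !l2B_coord !raddfB/=; ring.
  by apply/funext => s; rewrite l2B_coord raddfB.
have dIm t n : 0 < t < T -> is_derive t 1 (fun s => complex.Im (x s n))
    (- complex.Re (lap (x t) n) + Q t n).
  move=> /andP[t0 _]; have := dIm1 t n t0; have := dIm2 t n t0 => D2 D1.
  rewrite (_ : (fun _ => _) = (fun t => complex.Im (phi t n)) - (fun t => complex.Im (psi t n))).
    by apply: is_derive_eq; rewrite xlap /Q !l2B_coord !raddfB/=; ring.
  by apply/funext => s; rewrite l2B_coord raddfB.
have xM t : 0 < t < T -> `|x t| ^+ 2 <= (2 * M) ^+ 2.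
  move=> /andP[/ltW t0 /ltW tT]; have t0T : 0 <= t <= T by rewrite t0.
  have := ler_normB (phi t) (psi t); have := phiM t t0T; have := psiM t t0T => A B D.
  have xt : `|x t| <= 2 * M by rewrite (le_trans D)//; lra.
  by apply: lerXn2r => //; rewrite nnegrE//; exact: le_trans xt.
have PQ (w : int -> R) N t : (forall n, 0 <= w n) -> 0 < t < T ->
  \sum_(n <- box N) w n *
    (2 * (complex.Re (x t n) * P t n + complex.Im (x t n) * Q t n)) <=
  a * wsum w N (x t) + 0.
  move=> w0 /andP[/ltW t0 /ltW tT]; have t0T : 0 <= t <= T by rewrite t0.
  rewrite addr0 /wsum mulr_sumr; apply: ler_sum => n _; rewrite [leRHS]mulrCA ler_wpM2l//.
  rewrite sqr_normRcomplex /P /Q /x l2B_coord !raddfB/=.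
  have := cubic_difference_le (le_trans (coord_le _ n) (phiM t t0T))
    (le_trans (coord_le _ n) (psiM t t0T)).
  move=> /= /(ler_wpM2l (normr_ge0 gamma)); rewrite -normrM.
  move=> /(le_trans (ler_norm _)).
  set p := complex.Re _ - _; set q := complex.Im _ - _.
  have := mulr_ge0 (ltW d0) (addr_ge0 (sqr_ge0 p) (sqr_ge0 q)).
  have := addr_ge0 (sqr_ge0 p) (sqr_ge0 q).
  rewrite /a; lra.
apply: sqnorm_le => K.
apply: (@le_of_forall_invn _ _ _ (expR (a * T) * (8 * M ^+ 2 / a))) => L.
have LN : (L.+1 <= maxn L.+1 K)%N by rewrite leq_maxl.
have N0 : (0 < maxn L.+1 K)%N by apply: leq_trans LN.
have KN : (K <= maxn L.+1 K)%N by rewrite leq_maxr.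
move: (maxn _ _) LN N0 KN => N LN N0 KN.
apply: le_trans (boxsum_mono _ KN) _.
apply: le_trans (boxsum_le_wsum _ N0) _.
have := weighted_energy_le T0 (lt0r_neq0 a0) cRe cIm dRe dIm xM
  (fun n => @cutoff0 _ N n N0) (fun n => cutoff_lip n N0) (fun t => PQ _ _ t (cutoff_ge0 N)).
rewrite addr0; set c := _ / a => H.
have c0 : 0 <= c.
  apply: divr_ge0; last exact: ltW.
  by apply: mulr_ge0; [rewrite mulr_ge0|exact: sqr_ge0].
have cL : c <= 8 * M ^+ 2 / a / L.+1%:R.
  rewrite /c exprMn (_ : _ / a = 8 * M ^+ 2 / a * N%:R^-1); last by ring.
  rewrite ler_wpM2l//.
    by apply: divr_ge0; [rewrite mulr_ge0 ?sqr_ge0|exact: ltW].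
  by rewrite lef_pV2 ?ler_nat// posrE ltr0n.
apply: (@le_trans _ _ (wsum (cutoff N) N.*2 (x T) + c)); first by rewrite lerDl.
apply: le_trans H _; rewrite -mulrA -mulrDr ler_wpM2l ?expR_ge0//.
by apply: lerD => //; exact: wsum_cutoff_le.
Qed.

End estimates.

(** * The attractor of the dfDNLS *)

Lemma ler_sqr_normr (R : realType) (V : normedZmodType R) (v : V) (y : R) :
  `|v| <= y -> `|v| ^+ 2 <= y ^+ 2.
Proof. by move=> vy; apply: lerXn2r => //; rewrite nnegrE//; exact: le_trans vy. Qed.

(** Decay like [1 / x] suffices below and gives explicit waiting times. *)
Lemma expRN_le (R : realType) (x : R) : 0 < x -> expR (- x) <= x^-1.
Proof.
move=> x0; rewrite expRN lef_pV2 ?posrE ?expR_gt0//.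
by have := expR_ge1Dx x; lra.
Qed.

Lemma ler_norm_of_sqr (R : realType) (V : normedZmodType R) (u : V) (m : R) : 0 <= m -> `|u| ^+ 2 <= m -> `|u| <= 1 + m.
Proof. by move=> m0 um; rewrite -(@ler_pXn2r _ 2)// ?nnegrE ?addr_ge0//; nra. Qed.

(** Closedness of this set, and of the one in the next lemma, carries bounds on orbit tails over to
    their closures. *)
Lemma closed_norm_le (R : realType) (M : R) : closed [set x : l2 R | `|x| <= M].
Proof.
rewrite (_ : mkset _ = (fun x : l2 R => `|x|) @^-1` [set y | y <= M])//.
by apply: closed_comp; [move=> x _; exact: norm_continuous|exact: closed_le].
Qed.

Lemma closed_tail_le (R : realType) K (e : R) : closed [set x : l2 R | `|x| ^+ 2 - boxsum K x <= e].
Proof.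
have cnt (x : l2 R) : (fun y : l2 R => `|y| ^+ 2 - boxsum K y) @ nbhs x -->
    `|x| ^+ 2 - boxsum K x.
  apply: cvgB.
    under eq_fun do rewrite expr2.
    by rewrite expr2; apply: cvgM; exact: norm_continuous.
  apply: cvg_sum_seq => n; under eq_fun do rewrite sqr_normRcomplex !expr2.
  rewrite sqr_normRcomplex !expr2.
  have cRe : (fun y : l2 R => complex.Re (y n)) @ nbhs x --> complex.Re (x n).
    by apply: (cvg_coord (@normr_Re_le R)); exact: cvg_id.
  have cIm : (fun y : l2 R => complex.Im (y n)) @ nbhs x --> complex.Im (x n).
    by apply: (cvg_coord (@normr_Im_le R)); exact: cvg_id.
  by apply: cvgD; apply: cvgM; by [exact: cRe|exact: cIm].
rewrite (_ : mkset _ = (fun x : l2 R => `|x| ^+ 2 - boxsum K x) @^-1` [set y | y <= e])//.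
by apply: closed_comp; [move=> x _; exact: cnt|exact: closed_le].
Qed.

Section dfDNLS_dynamics.
Context {R : realType} {delta gamma : R} {g : l2 R} {S : R -> l2 R -> l2 R}.
Context (delta_gt0 : 0 < delta).
Context (S_semigroup : dfDNLS_semigroup delta gamma g S).

Let G := (`|g| / delta) ^+ 2.

Let G_ge0 : 0 <= G. Proof. exact: sqr_ge0. Qed.

Let S_weak u : weak_solution delta gamma g (fun t => S t u).
Proof. exact: dfDNLS_solution_weak (S_semigroup u). Qed.

Let S0 u : S 0 u = u. Proof. by case: (S_semigroup u). Qed.

Lemma S_sqnorm_le t u : 0 <= t ->
  `|S t u| ^+ 2 <= expR (- delta * t) * `|u| ^+ 2 + G.
Proof. by move=> t0; have := weak_solution_sqnorm_le delta_gt0 (S_weak u) t0; rewrite S0. Qed.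

Lemma S_sqnorm_growth t u : 0 <= t -> `|S t u| ^+ 2 <= `|u| ^+ 2 + G.
Proof.
move=> t0; apply: le_trans (S_sqnorm_le u t0) _; rewrite lerD2r ler_piMl ?sqr_ge0//.
by rewrite -expR0 ler_expR mulNr oppr_le0 mulr_ge0// ltW.
Qed.

Lemma S_sqnorm_inv_le t u : 0 < t ->
  `|S t u| ^+ 2 <= `|u| ^+ 2 / (delta * t) + G.
Proof.
move=> t0; apply: le_trans (S_sqnorm_le u (ltW t0)) _.
rewrite lerD2r mulrC ler_wpM2l ?sqr_ge0// mulNr.
by apply: expRN_le; exact: mulr_gt0.
Qed.

(** Both sides are weak solutions in [s] with the same initial value, and the Lipschitz estimate
    forces them to agree. *)
Lemma S_add s t u : 0 <= s -> 0 <= t -> S (s + t) u = S s (S t u).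
Proof.
move=> s0 t0; apply/eqP; rewrite -subr_eq0 -normr_eq0 -sqrf_eq0 eq_le sqr_ge0 andbT.
have W1 := weak_solution_shift t0 (S_weak u).
have W2 := S_weak (S t u).
have [M1 H1] := weak_solution_bounded s W1.
have [M2 H2] := weak_solution_bounded s W2.
have := @weak_solution_lipschitz _ _ _ _ _ _ _ (Num.max M1 M2) delta_gt0 W1 W2 s0.
rewrite add0r S0 subrr normr0 expr0n mulr0; apply.
- by move=> a aT; rewrite le_max H1.
- by move=> a aT; rewrite le_max H2 ?orbT.
Qed.

Lemma S_continuous t : 0 <= t -> continuous (S t).
Proof.
(* All orbits starting within distance 1 of [u] have squared norm at most [m], which gives them the
   common Lipschitz constant [L]. *)
move=> t0 u; pose m := (`|u| + 1) ^+ 2 + G.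
have m0 : 0 <= m by rewrite addr_ge0 ?sqr_ge0.
pose L := expR ((8 * `|gamma| * (1 + m) ^+ 2 + 1) * t).
have L0 : 0 < L by exact: expR_gt0.
have SL v : `|u - v| < 1 -> `|S t u - S t v| ^+ 2 <= L * `|u - v| ^+ 2.
  move=> uv; have bnd w : `|w| <= `|u| + 1 -> forall s, 0 <= s <= t -> `|S s w| <= 1 + m.
    move=> wu s /andP[s0 _]; apply: ler_norm_of_sqr => //.
    by apply: le_trans (S_sqnorm_growth w s0) _; rewrite lerD2r; exact: ler_sqr_normr.
  have := @weak_solution_lipschitz _ _ _ _ _ _ _ (1 + m) delta_gt0 (S_weak u) (S_weak v) t0.
  rewrite !S0; apply; apply: bnd; first by rewrite lerDl.
  by rewrite -[v](subKr u) (le_trans (ler_normB _ _))// lerD2l ltW.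
apply/(@cvgrPdist_lt _ _ _ _ (nbhs_filter u)) => e e0; near=> v.
have uv1 : `|u - v| < 1 by near: v; apply: cvgr_dist_lt; [exact: cvg_id|].
have uve : `|u - v| < e / Num.sqrt L.
  by near: v; apply: cvgr_dist_lt; [exact: cvg_id|rewrite divr_gt0// sqrtr_gt0].
rewrite -(@ltr_pXn2r _ 2)// ?nnegrE ?(ltW e0)//.
apply: le_lt_trans (SL _ uv1) _.
rewrite -[X in X * _](sqr_sqrtr (ltW L0)) -exprMn ltrXn2r// ?nnegrE ?mulr_ge0 ?(ltW e0)//.
by rewrite mulrC -ltr_pdivlMr// sqrtr_gt0.
Unshelve. all: by end_near. Qed.

Definition absorbing_ball : set (l2 R) := [set u | `|u| ^+ 2 <= G + 1].

Lemma absorbing_ball_absorbs B : bounded_set B ->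
  exists2 s : R, 0 <= s & forall t, s <= t -> S t @` B `<=` absorbing_ball.
Proof.
move=> [M [_ /(_ (M + 1))]]; rewrite ltrDl ltr01 => /(_ isT) BM.
(* From this time on [|u|^2 / (delta t) <= 1], the margin by which the squared radius of the ball
   exceeds [G]; the inner 1 keeps [delta t] positive. *)
exists (((M + 1) ^+ 2 + 1) / delta).
  by apply: divr_ge0; [rewrite addr_ge0 ?sqr_ge0|exact: ltW].
move=> t st _ [u Bu <-].
have d1 : (M + 1) ^+ 2 + 1 <= delta * t by rewrite mulrC -ler_pdivrMr.
have M2 : 0 <= (M + 1) ^+ 2 by exact: sqr_ge0.
have dt0 : 0 < delta * t by lra.
have t0 : 0 < t by rewrite -(pmulr_rgt0 _ delta_gt0).
rewrite /absorbing_ball/=; apply: le_trans (S_sqnorm_inv_le u t0) _.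
rewrite addrC lerD2l ler_pdivrMr// mul1r.
have uM : `|u| ^+ 2 <= (M + 1) ^+ 2.
  exact/ler_sqr_normr/BM.
by lra.
Qed.

Lemma S_asymptotically_compact (F : set_system (l2 R)) : UltraFilter F ->
  (forall s : R, 0 <= s -> F (closure (orbit_tail S absorbing_ball s))) ->
  exists p : l2 R, F --> p.
Proof.
move=> FU FO; pose m := G + 1 + G.
have m0 : 0 <= m by rewrite !addr_ge0.
have Sm t u : 0 <= t -> absorbing_ball u -> `|S t u| ^+ 2 <= m.
  by move=> t0 Bu; apply: le_trans (S_sqnorm_growth u t0) _; rewrite lerD2r.
apply: (@l2_ultra_cvg _ F (1 + m)) => [|e e0].
  apply: filterS (FO 0 (lexx 0)); rewrite closureE; apply: smallest_sub.
    exact: closed_norm_le.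
  by move=> _ [t /= t0 [u Bu <-]]; apply: ler_norm_of_sqr => //; exact: Sm.
(* The time-independent part of the tail bound at scale [K + 1]. First [K] is chosen to make it less
   than [e / 2], then [s] to make the exponential part at most [e / 2] from time [s] on. *)
pose q K := (2 * (2 / K.+1%:R) * m + delta^-1 * (`|g| ^+ 2 - boxsum K.+1 g)) / delta.
have q0 : q K @[K --> \oo] --> 0.
  rewrite -[X in _ --> X](mul0r delta^-1); apply: cvgM; last exact: cvg_cst.
  rewrite -(addr0 0); apply: cvgD.
    rewrite -(mul0r m); apply: cvgM; last exact: cvg_cst.
    rewrite -(mulr0 2); apply: cvgM; first exact: cvg_cst.
    by rewrite -(mulr0 2); apply: cvgM; [exact: cvg_cst|exact: cvg_harmonic].
  rewrite -(mulr0 delta^-1); apply: cvgM; first exact: cvg_cst.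
  rewrite -(subrr (`|g| ^+ 2)); apply: cvgB; first exact: cvg_cst.
  by have := @boxsum_cvg R g; rewrite -cvg_shiftS.
have e2 : 0 < e / 2 by rewrite divr_gt0.
have [K qK] : exists K, q K < e / 2.
  by have [K] := @filter_ex _ \oo _ _ (cvgr_lt _ q0 _ e2); exists K.
exists K.+1.*2.
pose s := (2 * (G + 1) / e + 1) / delta.
have s0 : 0 < s by rewrite divr_gt0// ltr_wpDl// divr_ge0 ?mulr_ge0 ?addr_ge0// ltW.
apply: filterS (FO s (ltW s0)); rewrite closureE; apply: smallest_sub.
  exact: closed_tail_le.
move=> _ [t /= st [u Bu <-]]; have t0 : 0 < t := lt_le_trans s0 st.
have Smt a : 0 <= a <= t -> `|S a u| ^+ 2 <= m by move=> /andP[a0 _]; exact: Sm.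
apply: le_trans (weak_solution_tail_le delta_gt0 (S_weak u) (ltW t0) (ltn0Sn K) Smt) _.
rewrite S0 -/(q K).
have : expR (- delta * t) * `|u| ^+ 2 <= e / 2.
  apply: (@le_trans _ _ ((delta * t)^-1 * (G + 1))).
    by apply: ler_pM; rewrite ?expR_ge0 ?sqr_ge0// mulNr expRN_le// mulr_gt0.
  rewrite mulrC ler_pdivrMr ?mulr_gt0//.
  have : 2 * (G + 1) / e + 1 <= delta * t by rewrite [leRHS]mulrC -ler_pdivrMr.
  move=> /(ler_wpM2l (ltW e2)) H; apply: le_trans H.
  rewrite [leRHS](_ : _ = G + 1 + e / 2); first by rewrite lerDl ltW.
  by field; rewrite gt_eqF.
by have := ltW qK; lra.
Qed.

Lemma dfDNLS_omega_limit_attractor :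
  global_attractor S (omega_limit S absorbing_ball).
Proof.
apply: omega_limit_global_attractor.
- exact: S_add.
- exact: S_continuous.
- by exists 0; rewrite /absorbing_ball/= normr0 expr0n addr_ge0.
- exact: absorbing_ball_absorbs.
- exact: S_asymptotically_compact.
Qed.

(** By invariance [u] is reached from a point of the bounded set [A] in an arbitrarily long time, so
    the contribution of the starting point fades. *)
Lemma dfDNLS_attractor_norm_le A u : global_attractor S A -> A u ->
  `|u| <= `|g| / delta.
Proof.
move=> [_ cA invA _] Au.
have [M [_ /(_ (M + 1))]] : bounded_set A by exact: compact_bounded.
rewrite ltrDl ltr01 => /(_ isT) AM.
rewrite -(@ler_pXn2r _ 2)// ?nnegrE ?divr_ge0 ?(ltW delta_gt0)//.
apply: (@le_of_forall_invn _ _ _ ((M + 1) ^+ 2)) => N.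
(* At this time [delta t = N + 1], so the decaying term is at most [(M + 1)^2 / (N + 1)]. *)
have t0 : 0 < N.+1%:R / delta by rewrite divr_gt0.
have : (S (N.+1%:R / delta) @` A) u by rewrite invA// ltW.
move=> [v Av <-]; apply: le_trans (S_sqnorm_inv_le v t0) _.
rewrite addrC lerD2l [delta * _]mulrC divfK ?gt_eqF// ler_wpM2r ?invr_ge0//.
exact/ler_sqr_normr/AM.
Qed.

End dfDNLS_dynamics.

Unset Implicit Arguments.

Theorem theoremV1 (R : realType) (delta gamma r : R) (g : l2 R)
    (S : R -> l2 R -> l2 R) :
  0 < delta ->
  2 / delta * `|g| < r ->
  dfDNLS_semigroup delta gamma g S ->
  exists A : set (l2 R),
    [/\ global_attractor S A,
        forall A' : set (l2 R), global_attractor S A' -> A' = A &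
        A `<=` [set u : l2 R | `|u| < r]].
Proof.
move=> delta0 gr Ssg.
have attr := dfDNLS_omega_limit_attractor delta0 Ssg.
exists (omega_limit S (@absorbing_ball R delta g)); split=> //.
  by move=> A' attr'; apply/seteqP; split; [exact: (global_attractor_subset attr)|exact: (global_attractor_subset attr')].
move=> u Au /=; apply: le_lt_trans (dfDNLS_attractor_norm_le delta0 Ssg attr Au) _.
(* The radius [|g| / delta] is half of the threshold that [r] exceeds. *)
apply: le_lt_trans gr; rewrite mulrAC -mulrA ler_peMl ?ler1n//.
by rewrite divr_ge0// ltW.
Qed.
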